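(* Let $K$ be a connected oriented linkoid diagram on $S^2$ with exactly one knotoidal component and $\ell\ge 0$ loop components. Let $D^t$ (resp. $D^h$) be the starred diagram obtained from $K$ by placing a star in the region of $K$ containing the tail (resp. the head) of the knotoidal component. Then \[ \nabla_{D^t}(W)=\nabla_{D^h}(-W^{-1}). \]
   Context: A linkoid diagram on $S^2$ is an immersion of a disjoint union of oriented intervals and oriented circles into $S^2$ whose only singularities are transverse double points away from the interval endpoints, each endowed with over/under information (these are the crossings). Images of intervals are knotoidal components, oriented from tail (image of $0$) to head (image of $1$); images of circles are loop components. Diagrams are considered up to isotopy of $S^2$ and Reidemeister moves R1, R2, R3 that do not move arcs over or under the endpoints. The diagram is connected if its universe (the graph with crossings as degree-4 vertices, endpoints as degree-1 vertices) is connected. A starred diagram has some regions marked with a star; stars may not be crossed by moves, and starred regions do not participate in states. Mock Alexander polynomial: for a connected starred diagram with equally many crossings and unstarred regions (admissible), assign local weights in the four quadrants at each crossing: the two quadrants each bounded by one incoming and one outgoing half-strand receive weight $1$; at a positive crossing the quadrant between the two incoming half-strands receives $W$ and the quadrant between the two outgoing half-strands receives $-B$; at a negative crossing these two quadrants receive $B$ and $-W$ respectively (Kauffman's Formal Knot Theory convention). A state is a choice, for each crossing, of one of its four quadrants lying in an unstarred region, such that the induced map from crossings to unstarred regions is a bijection. The potential is $\nabla(W,B)=\sum_{\text{states}}\prod_{\text{crossings}}(\text{weight of chosen quadrant})$, and the mock Alexander polynomial is $\nabla(W)=\nabla(W,W^{-1})$. For a connected spherical diagram with one knotoidal component, the number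 of regions is one more than the number of crossings, so placing one star makes it admissible. *)

(* Defs.v *)
(* Combinatorial model of a connected linkoid diagram on S^2
   with exactly one knotoidal component, as an oriented combinatorial map
   (rotation system) of its universe. *)
From HB Require Import structures.
From mathcomp Require Import all_boot all_order all_algebra.
Set Implicit Arguments. Unset Strict Implicit. Unset Printing Implicit Defensive.
Import GRing.Theory.
Local Open Scope ring_scope.

(* Darts (half-edges) of the universe of a diagram with n crossings:
   inl (c, i) = the i-th half-strand at crossing c, i : 'I_4, numbered in
   counterclockwise order around c (w.r.t. the orientation of S^2);
   inr false  = the unique half-edge at the tail endpoint,
   inr true   = the unique half-edge at the head endpoint. *)
Definition dart (n : nat) : finType := (('I_n * 'I_4) + bool)%type.

(* Labelling convention at crossing c: half-strand 0 is the incoming over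
   half-strand, 2 the outgoing over half-strand; the under strand is 1-3.
   sgn c = true (positive crossing): 1 is incoming under, 3 outgoing under;
   sgn c = false (negative crossing): 3 is incoming under, 1 outgoing under.
   (Positive = right-handed: the under direction is the over direction rotated
   counterclockwise by 90 degrees; then ccw order from the incoming over
   half-strand is in-over, in-under, out-over, out-under.)
   is_in sgn d : the half-edge d points into its vertex.  At the tail the
   strand leaves (outgoing), at the head it arrives (incoming). *)
Definition is_in n (sgn : 'I_n -> bool) (d : dart n) : bool :=
  match d with
  | inl (c, i) => (i == 0 :> nat) || (i == (if sgn c then 1 else 3)%N :> nat)
  | inr b => b
  end.

Definition rot n (d : dart n) : dart n :=
  match d with
  | inl (c, i) => inl (c, ordS i)
  | inr b => inr b
  end.

(* Face step: the corner (d, rot d) is followed, along the boundary of its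
   region, by the corner (alpha (rot d), rot (alpha (rot d))).  Regions of the
   diagram = orbits of fstep; the corner indexed by d lies in the region
   of d. *)
Definition fstep n (alpha : dart n -> dart n) (d : dart n) : dart n :=
  alpha (rot d).

Definition nfaces n (alpha : dart n -> dart n) : nat :=
  #|[set froot (fstep alpha) d | d : dart n]|.

Definition adj n (alpha : dart n -> dart n) : rel (dart n) :=
  fun x y => (y == alpha x) || (y == rot x).

Record diagram (n : nat) := Diagram {
  sgn : 'I_n -> bool;
  alpha : dart n -> dart n;           (* edges: pairing of half-edges *)
  alphaK : involutive alpha;
  alpha_orient : forall d, is_in sgn (alpha d) = ~~ is_in sgn d;
  diag_connected : forall x y, connect (adj alpha) x y;
  (* the map is spherical: Euler characteristic V - E + F = 2, with
     V = n + 2 vertices, E = 2n + 1 edges *)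
  diag_sphere : (n + 2 + nfaces alpha = 2 + (2 * n + 1))%N
}.

Section Potential.
Variables (n : nat) (K : diagram n) (R : comUnitRingType).

Definition same_region (d e : dart n) : bool := fconnect (fstep (alpha K)) d e.

(* quadrant q at crossing c: the corner between half-strands q and q+1 *)
Definition quad (c : 'I_n) (q : 'I_4) : dart n := inl (c, q).

Definition weight (W B : R) (c : 'I_n) (q : 'I_4) : R :=
  let a := is_in (sgn K) (inl (c, q)) in
  let b := is_in (sgn K) (inl (c, ordS q)) in
  if a && b then (if sgn K c then W else B)
  else if ~~ a && ~~ b then (if sgn K c then - B else - W)
  else 1.

(* States of the diagram starred at the region containing the dart [star]:
   a choice of quadrant per crossing, in unstarred regions, inducing a
   bijection from crossings onto unstarred regions. *)
Definition is_state (star : dart n) (st : {ffun 'I_n -> 'I_4}) : bool :=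
  [&& [forall c, ~~ same_region star (quad c (st c))],
      [forall c1, forall c2,
         same_region (quad c1 (st c1)) (quad c2 (st c2)) ==> (c1 == c2)] &
      [forall d, same_region star d ||
                 [exists c, same_region (quad c (st c)) d]]].

Definition potential (star : dart n) (W B : R) : R :=
  \sum_(st : {ffun 'I_n -> 'I_4} | is_state star st)
     \prod_(c < n) weight W B c (st c).

(* mock Alexander polynomial evaluated at a unit w: nabla(w, w^-1) *)
Definition mockAlex (star : dart n) (w : R) : R := potential star w w^-1.

End Potential.

Definition tail_dart n : dart n := inr false.
Definition head_dart n : dart n := inr true.

(* Main.v *)
Require Import Defs.
From HB Require Import structures.
From mathcomp Require Import all_boot all_order all_algebra all_fingroup all_field zify ring.
(** Write In, R, Out, L for the regions at the four quadrants of a crossing (In between the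
    incoming, Out between the outgoing half-strands), and B = 1/W.

    (1) Two states with the same star differ by a cocycle modulo 2 on the spherical map, hence by
    the coboundary of a set of edges.  Comparing signs of permutations of the darts of that set
    shows that the sign of a state, as a permutation from crossings to regions, is up to a global
    constant the parity of its markers in Out (star at the head) or in In (star at the tail).  So
    both potentials are, up to a global sign, minors of a crossings-by-regions matrix.

    (2) Attach to an edge with right region R and left region L the quantity y = R - W L.  The row
    of a crossing is a linear relation between incoming and outgoing y's.  Together with the
    relation satisfied by the four y's around any crossing it gives a scattering matrix S for the
    tail problem, and the inverse transpose of S for the head problem.  Transposing I - S
    therefore identifies the two minors, up to the sign of the strand permutation.

    (3) This identity holds for all p, q, om with (p + q) om = 1 + om^2.  At om = i, p = 1,
    q = -1 all weights become 1, so the global sign relates two numbers of states and is + as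
    soon as some state exists. *)

Set Implicit Arguments. Unset Strict Implicit. Unset Printing Implicit Defensive.
Import GRing.Theory Num.Theory.

(** * Signs of restricted permutations *)

(** [r] picks one representative on every cycle of [s], so its image counts the cycles. *)
Lemma card_porbits_retract (T : finType) (s : {perm T}) (r : T -> T) :
  (forall x, r (s x) = r x) -> (forall x, r x \in porbit s x) ->
  #|porbits s| = #|[set r x | x in T]|.
Proof.
move=> rs rp.
have rk x k : r ((s ^+ k)%g x) = r x.
  elim: k => [|k IH]; first by rewrite expg0 perm1.
  by rewrite expgSr permM rs.
have -> : porbits s = porbit s @: [set r x | x in T].
  rewrite /porbits -imset_comp; apply: eq_imset => x /=.
  by apply/eqP; rewrite eq_porbit_mem porbit_sym.
rewrite card_in_imset // => _ _ /imsetP[x _ ->] /imsetP[y _ ->] E.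
have rr z : r (r z) = r z by case/porbitP: (rp z) => k {1}->; rewrite rk.
have: r x \in porbit s (r y) by rewrite -E porbit_id.
by case/porbitP=> k /(congr1 r); rewrite rk !rr.
Qed.

Lemma restr_perm_id (T : finType) (D : {set T}) (s : {perm T}) x :
  x \notin D -> restr_perm D s x = x.
Proof. by move=> xD; apply: (out_perm (restr_perm_on D s)). Qed.

Lemma perm_astabs (T : finType) (D : {set T}) (s : {perm T}) :
  (forall x, x \in D -> s x \in D) -> s \in 'N(D | 'P)%g.
Proof.
move=> sD; have sN : s @: D = D.
  apply/eqP; rewrite eqEcard card_imset ?leqnn ?andbT; last exact: perm_inj.
  by apply/subsetP=> _ /imsetP[x xD ->]; apply: sD.
by apply/astabsP=> x; rewrite /= apermE -[in X in X = _]sN mem_imset //; exact: perm_inj.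
Qed.

(** The sign of a permutation is the parity of the number of points minus the number of cycles. On
    [D] the set [X] is a transversal of the cycles; a point outside [D] is a cycle of its own and
    cancels. *)
Lemma odd_restr_perm (T : finType) (D X : {set T}) (s : {perm T}) (r : T -> T) :
  (forall x, x \in D -> s x \in D) -> X \subset D ->
  (forall x, x \in X -> r x = x) ->
  (forall x, x \in D -> r x \in X) -> (forall x, x \in D -> r (s x) = r x) ->
  (forall x, x \in D -> exists k, r x = (s ^+ k)%g x) ->
  odd_perm (restr_perm D s) = odd #|D| (+) odd #|X|.
Proof.
move=> sD XD rX rDX rs rk.
have sN := perm_astabs sD.
have skD k x : x \in D -> (s ^+ k)%g x \in D.
  by move=> xD; elim: k => [|k IH]; rewrite ?expg0 ?perm1 // expgSr permM sD.
pose r' x := if x \in D then r x else x.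
rewrite /odd_perm (@card_porbits_retract _ _ r').
- have -> : [set r' x | x in T] = X :|: ~: D.
    apply/setP=> y; apply/imsetP/setUP=> [[x _ ->]|[yX|yD]].
    + rewrite /r'; case: ifP => xD; first by left; apply: rDX.
      by right; rewrite inE xD.
    + by exists y => //; rewrite /r' (subsetP XD) // rX.
    + by exists y => //; rewrite /r'; move: yD; rewrite inE => /negbTE ->.
  rewrite cardsU.
  have -> : X :&: ~: D = set0.
    by apply/eqP; rewrite setI_eq0 disjoints_subset setCK.
  rewrite cards0 subn0 -(cardsC D) !oddD.
  by case: (odd _); case: (odd _); case: (odd _).
- move=> x; rewrite /r'; have [xD|xD] := boolP (x \in D).
    by rewrite restr_permE // sD // rs.
  by rewrite restr_perm_id // (negbTE xD).
- move=> x; rewrite /r'; case: ifP => xD; last exact: porbit_id.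
  have [k ->] := rk x xD; apply/porbitP; exists k.
  elim: k => [|k IH]; first by rewrite !expg0.
  by rewrite !expgSr !permM -IH restr_permE // skD.
Qed.

(** Write [u] as a product of transpositions and carry each factor along [m]: [v] is a product of
    the same length. *)
Lemma odd_perm_inj (I T : finType) (m : I -> T) (u : {perm I}) (v : {perm T}) :
  injective m -> (forall i, v (m i) = m (u i)) ->
  (forall x, x \notin codom m -> v x = x) -> odd_perm v = odd_perm u.
Proof.
move=> mI vm vx; case: (prod_tpermP u) => ts uts dts.
pose f (t : I * I) := (m t.1, m t.2).
have -> : v = (\prod_(t <- map f ts) tperm t.1 t.2)%g.
  apply/permP=> x; have [/codomP[i ->]|xm] := boolP (x \in codom m).
    rewrite vm {}uts {dts}; elim: ts i => [|t ts IH] i.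
      by rewrite !big_nil !perm1.
    by rewrite /= !big_cons /f /= !permM -inj_tperm // IH.
  rewrite vx // {uts dts}; elim: ts => [|t ts IH]; first by rewrite big_nil perm1.
  rewrite /= big_cons /f /= permM tpermD //; apply/eqP=> E; rewrite -E in xm;
    by rewrite codom_f in xm.
rewrite odd_perm_prod; last first.
  by rewrite all_map; apply: sub_all dts => t; rewrite /dpair /= /f /= inj_eq.
by rewrite size_map uts odd_perm_prod.
Qed.

(** [m1 i] and [m2 i] may coincide; no other coincidence between the two families is allowed, so the
    exchange is a well-defined involution. *)
Lemma swap_perm (I T : finType) (m1 m2 : I -> T) :
  injective m1 -> injective m2 -> (forall i j, m1 i = m2 j -> i = j) ->
  exists s : {perm T}, [/\ forall i, s (m1 i) = m2 i, forall i, s (m2 i) = m1 i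
    & forall x, x \notin codom m1 -> x \notin codom m2 -> s x = x].
Proof.
move=> i1 i2 i12.
pose f x := if [pick i | m1 i == x] is Some i then m2 i
  else if [pick i | m2 i == x] is Some i then m1 i else x.
have f1 i : f (m1 i) = m2 i.
  by rewrite /f; case: pickP => [j /eqP/i1->//|/(_ i)]; rewrite eqxx.
have f2 i : f (m2 i) = m1 i.
  rewrite /f; case: pickP => [j /eqP E|_]; first by move: (E); rewrite (i12 _ _ E) => ->.
  by case: pickP => [j /eqP/i2->//|/(_ i)]; rewrite eqxx.
have f3 x : x \notin codom m1 -> x \notin codom m2 -> f x = x.
  move=> x1 x2; rewrite /f; case: pickP => [j /eqP E|_].
    by rewrite -E codom_f in x1.
  by case: pickP => [j /eqP E|//]; rewrite -E codom_f in x2.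
have fK : involutive f.
  move=> x; have [/codomP[i ->]|x1] := boolP (x \in codom m1); first by rewrite f1 f2.
  have [/codomP[i ->]|x2] := boolP (x \in codom m2); first by rewrite f2 f1.
  by rewrite !f3.
exists (perm (inv_inj fK)); split=> [i|i|x x1 x2]; rewrite permE //; exact: f3.
Qed.

(* Along every marked orbit of [t] the height [h] changes exactly at its mark in [P1] and at its
   mark in [P2].  Swapping the two marks by [tau] cuts the orbit into one cycle at height true
   and one at height false. *)
Section Twist.
Variables (T : finType) (t tau : {perm T}) (h : T -> bool) (P1 P2 : {set T}).
Hypothesis h_step : forall x, h (t x) = h x (+) (x \in P1) (+) (x \in P2).
Hypothesis P1_uniq : forall x y, x \in P1 -> y \in P1 -> y \in porbit t x -> x = y.
Hypothesis P2_uniq : forall x y, x \in P2 -> y \in P2 -> y \in porbit t x -> x = y.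
Hypothesis tau12 : forall x, x \in P1 -> tau x \in P2 /\ tau x \in porbit t x.
Hypothesis tau21 : forall x, x \in P2 -> tau x \in P1 /\ tau x \in porbit t x.
Hypothesis tau_id : forall x, x \notin P1 -> x \notin P2 -> tau x = x.

(** [tau] moves only marks and [h] changes only after a mark, so up to the first mark met from [x]
    the permutations [t] and [tau * t] run through the same points, at constant height. *)
Lemma twist_reach x y : y \in porbit t x -> y \in P1 :|: P2 ->
  exists k, [/\ (t ^+ k)%g x \in P1 :|: P2, h ((t ^+ k)%g x) = h x
    & ((tau * t) ^+ k)%g x = (t ^+ k)%g x].
Proof.
case/porbitP=> i -> Pi.
have [k Pk kmin] := ex_minnP (ex_intro (fun k => (t ^+ k)%g x \in P1 :|: P2) i Pi).
exists k; suff H j : j <= k -> h ((t ^+ j)%g x) = h x /\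
    ((tau * t) ^+ j)%g x = (t ^+ j)%g x by have [] := H k (leqnn k).
elim: j => [|j IH] jk; first by rewrite !expg0 !perm1.
have [hj ej] := IH (ltnW jk).
have : (t ^+ j)%g x \notin P1 :|: P2.
  by apply/negP=> /kmin; rewrite leqNgt jk.
rewrite inE negb_or => /andP[n1 n2].
by rewrite !expgSr !permM ej h_step (negbTE n1) (negbTE n2) !addbF tau_id.
Qed.

(** The height flips just after [x] and stays constant until the next mark. That mark has not the
    height of [x], so it is not [x]; by uniqueness it is [y]. *)
Lemma twist_neq x y : x \in P1 -> y \in P2 -> y \in porbit t x -> x != y ->
  h y = ~~ h x.
Proof.
move=> x1 y2 yx xy.
have x2 : x \notin P2.
  by apply: contra xy => x2; rewrite (P2_uniq x2 y2 yx).
have htx : h (t x) = ~~ h x by rewrite h_step x1 (negbTE x2) addbT addbF.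
have ytx : y \in porbit t (t x) by have := porbit_perm t 1 x; rewrite expg1 => ->.
have yP : y \in P1 :|: P2 by rewrite inE y2 orbT.
have [k [kP hk _]] := twist_reach ytx yP.
have kx : (t ^+ k)%g (t x) \in porbit t x.
  by apply/porbitP; exists k.+1; rewrite expgS permM.
move: kP; rewrite -htx -hk inE => /orP[k1|k2].
  by move: hk; rewrite -(P1_uniq x1 k1 kx) htx; case: (h x).
by congr h; apply: (P2_uniq y2 k2); rewrite (eqP (_ : porbit t y == porbit t x)) // eq_porbit_mem.
Qed.

(** At a mark, [tau] leads to the other mark, at the opposite height, and the following step of [t]
    flips the height back. If the two marks coincide, their flips cancel. *)
Lemma twist_stable x : h x -> h ((tau * t)%g x).
Proof.
rewrite permM => hx.
have [x1|x1] := boolP (x \in P1).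
  have [y2 yx] := tau12 x1.
  have [e|ne] := eqVneq x (tau x); first by rewrite -e h_step hx x1 e y2.
  rewrite h_step y2 (twist_neq x1 y2 yx ne) hx.
  case y1: (tau x \in P1) => //.
  by case/eqP: ne; apply: P1_uniq.
have [x2|x2] := boolP (x \in P2); last first.
  by rewrite tau_id // h_step hx (negbTE x1) (negbTE x2).
have [y1 yx] := tau21 x2.
have [e|ne] := eqVneq (tau x) x; first by rewrite -e y1 in x1.
rewrite h_step y1; have xy : x \in porbit t (tau x) by rewrite porbit_sym.
have := twist_neq y1 x2 xy ne; rewrite hx => /esym/negbTE->.
case y2: (tau x \in P2) => //.
by case/eqP: ne; rewrite -(P2_uniq x2 y2 yx).
Qed.

Hypothesis unmarked : forall x, h x -> t x = x \/
  (exists2 y, y \in porbit t x & y \in P1 :|: P2).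

(** Distinct marks of an orbit of [t] have opposite heights. Hence a cycle of [tau * t] at height
    true meets the last set exactly once: at its mark, or at its only point if it is unmarked. *)
Lemma odd_twist :
  odd_perm (restr_perm [set x | h x] (tau * t)%g) = odd #|[set x | h x]|
   (+) odd #|[set x | h x && ((x \in P1 :|: P2) || (t x == x))]|.
Proof.
set D := [set x | h x]; set X := [set x | _].
have Xuniq x y : x \in X -> y \in X -> y \in porbit t x -> x = y.
  rewrite !inE => /andP[hx Px] /andP[hy Py] yx.
  have fixE z : t z = z -> forall w, w \in porbit t z -> w = z.
    move=> tz w /porbitP[k ->]; elim: k => [|k IH]; first by rewrite expg0 perm1.
    by rewrite expgSr permM IH.
  case/orP: Px => [Px|/eqP tx]; last by rewrite (fixE _ tx _ yx).
  case/orP: Py => [Py|/eqP ty]; last by rewrite (fixE _ ty x) // porbit_sym.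
  have xy : x \in porbit t y by rewrite porbit_sym.
  case/orP: Px => Px; case/orP: Py => Py.
  - exact: P1_uniq.
  - by apply/eqP; apply: contraTT hy => ne; rewrite (twist_neq Px Py yx ne) hx.
  - by apply/eqP; apply: contraTT hx => ne;
      rewrite (twist_neq Py Px xy) ?hy // eq_sym.
  - exact: P2_uniq.
(* The element of [X] on the orbit of [x]; at height true the default [x] is never reached. *)
pose r x := if [pick y in porbit t x | y \in X] is Some y then y else x.
have XD x : x \in X -> h x by rewrite inE => /andP[].
have rE x y : y \in porbit t x -> y \in X -> r x = y.
  rewrite /r => yx yX; case: pickP => [z /andP[zx zX]|/(_ y)]; last by rewrite yx yX.
  by apply: Xuniq => //; rewrite (eqP (_ : porbit t z == porbit t x)) // eq_porbit_mem.
have rX x : h x -> exists y k, [/\ y \in porbit t x, y \in X & y = ((tau * t) ^+ k)%g x].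
  move=> hx; case: (unmarked hx) => [tx|[y yx yP]].
    by exists x, 0; rewrite porbit_id expg0 perm1; split=> //; rewrite inE hx tx eqxx orbT.
  have [k [kP hk ek]] := twist_reach yx yP.
  exists ((t ^+ k)%g x), k; rewrite mem_porbit ek; split=> //.
  by rewrite inE hk hx kP.
apply: (@odd_restr_perm _ D X _ r).
- by move=> x; rewrite !inE; exact: twist_stable.
- by apply/subsetP=> x /XD; rewrite inE.
- by move=> x xX; apply: rE => //; exact: porbit_id.
- by move=> x; rewrite inE => /rX[y [k [yx yX _]]]; rewrite (rE _ _ yx yX).
- move=> x; rewrite inE => /rX[y [k [yx yX _]]]; rewrite (rE _ _ yx yX).
  apply: rE => //; rewrite permM.
  have -> : porbit t (t (tau x)) = porbit t (tau x).
    by have := porbit_perm t 1 (tau x); rewrite expg1.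
  suff /eqP-> : porbit t (tau x) == porbit t x by [].
  rewrite eq_porbit_mem; have [/tau12[]//|x1] := boolP (x \in P1).
  have [/tau21[]//|x2] := boolP (x \in P2).
  by rewrite tau_id // porbit_id.
- move=> x; rewrite inE => /rX[y [k [yx yX e]]]; rewrite (rE _ _ yx yX).
  by exists k.
Qed.
End Twist.

(** * Exactness and scattering matrices *)

Section Exactness.
Local Open Scope ring_scope.
Variable F : fieldType.

Lemma leq_mxrank_const m n (M : 'M[F]_(m, n)) :
  (forall u : 'rV_m, u *m M = 0 -> forall i j, u 0 i = u 0 j) ->
  (m <= (\rank M).+1)%N.
Proof.
case: m M => [|m] M // H; rewrite -[X in (_ <= X)%N]addn1 -leq_subLR.
have : (kermx M <= (const_mx 1 : 'rV[F]_m.+1))%MS.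
  apply/row_subP=> i; set u := row i _.
  have u0 : u *m M = 0 by apply/sub_kermxP; apply: row_sub.
  have -> : u = u 0 0 *: const_mx 1.
    by apply/rowP=> j; rewrite [RHS]mxE [const_mx _ _ _]mxE mulr1; apply: H.
  by rewrite scalemx_sub.
by move/mxrankS; rewrite mxrank_ker => /leq_trans/(_ (rank_leq_row _)).
Qed.

(** Both outer kernels have dimension at most one, so the ranks are at least [#|A| - 1] and
    [#|C| - 1]. Together they fill the dimension [#|B|], which forces exactness in the middle. The
    cardinality equation will be Euler's formula. *)
Lemma exact_of_const_kernels (A B C : finType) (a : A -> B -> F) (b : B -> C -> F) :
  (forall x z, \sum_y a x y * b y z = 0) ->
  (forall u : A -> F, (forall y, \sum_x u x * a x y = 0) -> forall x x', u x = u x') ->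
  (forall v : C -> F, (forall y, \sum_z v z * b y z = 0) -> forall z z', v z = v z') ->
  (#|A| + #|C| = #|B| + 2)%N ->
  forall g : B -> F, (forall z, \sum_y g y * b y z = 0) ->
  exists u : A -> F, forall y, g y = \sum_x u x * a x y.
Proof.
move=> ab ha hb card g gb.
pose Ma := \matrix_(i < #|A|, j < #|B|) a (enum_val i) (enum_val j).
pose Mb := \matrix_(i < #|B|, j < #|C|) b (enum_val i) (enum_val j).
have sumE (T : finType) (f : T -> F) : \sum_(i < #|T|) f (enum_val i) = \sum_x f x.
  by rewrite [RHS](reindex (@enum_val T predT)) //; apply/onW_bij/enum_val_bij.
have ab0 : Ma *m Mb = 0.
  apply/matrixP=> i j; rewrite !mxE -[RHS](ab (enum_val i) (enum_val j)) -[RHS]sumE.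
  by apply: eq_bigr => k _; rewrite !mxE.
have ra : (#|A| <= (\rank Ma).+1)%N.
  apply: leq_mxrank_const => u u0 i j.
  rewrite -(enum_valK i) -(enum_valK j).
  apply: (ha (fun x => u 0 (enum_rank x))) => y.
  move/rowP/(_ (enum_rank y)): u0; rewrite !mxE => u0.
  rewrite -[RHS]u0 -[LHS]sumE.
  by apply: eq_bigr => k _; rewrite !mxE enum_rankK enum_valK.
have rb : (#|C| <= (\rank Mb).+1)%N.
  rewrite -mxrank_tr; apply: leq_mxrank_const => u u0 i j.
  rewrite -(enum_valK i) -(enum_valK j).
  apply: (hb (fun x => u 0 (enum_rank x))) => y.
  move/rowP/(_ (enum_rank y)): u0; rewrite !mxE => u0.
  rewrite -[RHS]u0 -[LHS]sumE.
  by apply: eq_bigr => k _; rewrite !mxE enum_rankK enum_valK.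
have sub : (Ma <= kermx Mb)%MS by rewrite sub_kermx ab0.
have le_ba : (kermx Mb <= Ma)%MS.
  rewrite -(geq_leqif (mxrank_leqif_sup sub)) mxrank_ker leq_subLR.
  by rewrite -(leq_add2r 2) -card addn2 -addSn -addnS addnC leq_add.
pose gr := \row_(j < #|B|) g (enum_val j).
have : (gr <= Ma)%MS.
  apply: submx_trans le_ba; rewrite sub_kermx; apply/eqP/rowP=> j.
  rewrite !mxE -[RHS](gb (enum_val j)) -[RHS]sumE.
  by apply: eq_bigr => k _; rewrite !mxE.
case/submxP=> D gD; exists (fun x => D 0 (enum_rank x)) => y.
move/rowP/(_ (enum_rank y)): gD; rewrite !mxE enum_rankK => ->.
by rewrite -[RHS]sumE; apply: eq_bigr => k _; rewrite !mxE enum_rankK enum_valK.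
Qed.
End Exactness.

(** In two states with the same star, index 0 goes to the same region; only a permutation of the
    crossings is left to compare. *)
Lemma odd_perm_fix_head m (s1 s2 : 'S_(1 + m)) :
  s1 (lshift m ord0) = s2 (lshift m ord0) ->
  exists2 u : 'S_m, forall c, s1 (rshift 1 c) = s2 (rshift 1 (u c)) &
    odd_perm s1 (+) odd_perm s2 = odd_perm u.
Proof.
move=> s12; pose v := (s1 * s2^-1)%g.
have v0 : v (lshift m ord0) = lshift m ord0 by rewrite permM s12 permK.
have caseI (j : 'I_(1 + m)) : j = lshift m ord0 \/ exists c, j == rshift 1 c.
  rewrite -(splitK j); case: (split j) => [i|c] /=; last by right; exists c.
  by left; rewrite (ord1 i).
have H c : exists c', v (rshift 1 c) == rshift 1 c'.
  case: (caseI (v (rshift 1 c))) => // E.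
  by have := @perm_inj _ v (rshift 1 c) (lshift m ord0); rewrite E v0 => /(_ erefl)/eqP;
    rewrite eq_rlshift.
pose f c := xchoose (H c).
have vf c : v (rshift 1 c) = rshift 1 (f c) by apply/eqP/(xchooseP (H c)).
have fI : injective f.
  by move=> c c' E; apply: (@rshift_inj 1 m); apply: (@perm_inj _ v); rewrite !vf E.
exists (perm fI) => [c|].
  by rewrite permE -vf permM permKV.
have -> : odd_perm s1 (+) odd_perm s2 = odd_perm v by rewrite odd_permM odd_permV.
apply: (@odd_perm_inj _ _ (@rshift 1 m)) => [|c|x xm].
- exact: rshift_inj.
- by rewrite permE -vf.
- case: (caseI x) => [->//|[c /eqP xc]]; by rewrite xc codom_f in xm.
Qed.

Lemma fconnect_porbit (T : finType) (f : T -> T) (fI : injective f) x y :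
  fconnect f x y -> y \in porbit (perm fI) x.
Proof.
move=> /iter_findex <-; apply/porbitP; exists (findex f x y).
by rewrite permX; apply: eq_iter => z; rewrite permE.
Qed.

(* [out_block 1 q - in_block 0 p * Pi] is the system of the tail problem and
   [in_block 1 q * Pi - out_block 0 p] that of the head problem; [scattering_dual] says that the
   two scattering matrices are inverse transposes, written without inverses. *)
Section Scattering.
Local Open Scope ring_scope.
Variables (F : fieldType) (om : F) (n : nat).
Implicit Types p q : 'rV[F]_n.

Definition out_block (e : F) q : 'M[F]_(1 + n + n) :=
  block_mx (block_mx e%:M 0 0 0) (col_mx 0 (diag_mx q)) (row_mx 0 1%:M) om%:M.

Definition in_block (e : F) q : 'M[F]_(1 + n + n) :=
  block_mx (block_mx e%:M 0 0 (om%:M - diag_mx q)) (col_mx 0 1%:M) (row_mx 0 om%:M) 1%:M.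

Lemma scattering_dual p q :
  (forall c, (p 0 c + q 0 c) * om = 1 + om ^+ 2) ->
  out_block 0 p *m (out_block 1 q)^T = in_block 1 q *m (in_block 0 p)^T.
Proof.
move=> pq.
(* Entrywise, [(om - q) (om - p) + 1] is [p q + (1 + om^2) - om (p + q)], and [pq] cancels the last
   terms. *)
have diagE : diag_mx p *m diag_mx q =
    (om%:M - diag_mx q) *m (om%:M - diag_mx p) + 1%:M :> 'M[F]_n.
  rewrite !mul_diag_mx mulmxBl mul_scalar_mx mul_diag_mx; apply/matrixP=> i j.
  rewrite !mxE; case: eqP => [_|_]; last by rewrite !mulr0n; ring.
  rewrite !mulr1n -[LHS]addr0 -(subrr (1 + om ^+ 2)) -{2}(pq i); ring.
have linE (r s : 'rV[F]_n) : (forall c, (r 0 c + s 0 c) * om = 1 + om ^+ 2) ->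
    om *: diag_mx r = om *: (om%:M - diag_mx s) + 1%:M :> 'M[F]_n.
  move=> rs; apply/matrixP=> i j; rewrite !mxE; case: eqP => [->|_]; last by rewrite !mulr0n; ring.
  rewrite !mulr1n -[LHS]addr0 -(subrr (1 + om ^+ 2)) -{2}(rs j); ring.
have qp c : (q 0 c + p 0 c) * om = 1 + om ^+ 2 by rewrite addrC.
have trS r : (om%:M - diag_mx r)^T = om%:M - diag_mx r :> 'M[F]_n.
  by rewrite linearB /= tr_scalar_mx tr_diag_mx.
rewrite /out_block /in_block !tr_block_mx !tr_col_mx !tr_row_mx !trmx0 !tr_diag_mx
  !tr_scalar_mx trS !mulmx_block !mulmx0 !mul0mx ?mulmx1.
have z0 m : 0%:M = 0 :> 'M[F]_m by rewrite raddf0.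
rewrite !z0 ?mulmx0 !mul_col_row ?mul_block_col ?mul_row_block ?mul_row_col.
rewrite !mul0mx !mulmx0 !mul1mx !addr0 !add0r ?add_block_mx ?mulmx1.
rewrite !mul_scalar_mx !mul_mx_scalar ?scale_col_mx ?scale_row_mx ?scaler0.
rewrite ?add_block_mx ?add_col_mx ?add_row_mx !addr0 ?add0r.
by rewrite diagE (linE _ _ pq) (linE _ _ qp) [1%:M + om *: _]addrC.
Qed.

(** Subtracting the last block row from the middle one makes the matrix block triangular. The value
    is the same as for [out_block], which gives [det_scattering] a common factor. *)
Lemma det_in_block q : \det (in_block 1 q) = \det (- diag_mx q).
Proof.
pose U : 'M[F]_(1 + n + n) := block_mx 1%:M (col_mx 0 (-1%:M)) 0 1%:M.
have detU : \det U = 1 by rewrite det_ublock !det1 mulr1.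
transitivity (\det (U *m in_block 1 q)); first by rewrite det_mulmx detU mul1r.
rewrite mulmx_block !mul1mx !mul0mx !add0r !mulmx1.
rewrite !mul_col_row !mul0mx !mulNmx !mul1mx !oppr0 add_block_mx !addr0.
rewrite add_col_mx addr0 subrr col_mx0 det_lblock det_lblock !det1 mul1r mulr1.
by rewrite addrAC subrr add0r.
Qed.

(** Two column operations: add the last block column to the middle one, then subtract the middle one
    from the last. *)
Lemma det_out_block q : \det (out_block 1 q) = \det (- diag_mx q).
Proof.
pose V1 : 'M[F]_(1 + n + n) := block_mx 1%:M 0 (row_mx 0 1%:M) 1%:M.
pose V2 : 'M[F]_(1 + n + n) := block_mx 1%:M (col_mx 0 (-1%:M)) 0 1%:M.
have detV1 : \det V1 = 1 by rewrite det_lblock !det1 mulr1.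
have detV2 : \det V2 = 1 by rewrite det_ublock !det1 mulr1.
transitivity (\det (out_block 1 q *m V1 *m V2)).
  by rewrite !det_mulmx detV1 detV2 !mulr1.
rewrite !mulmx_block !mulmx1 !mulmx0 !addr0 !add0r.
rewrite !mul_col_row !mul0mx !mulmx1 add_block_mx !addr0 !add0r.
rewrite mul_block_col !mul0mx !mulmx0 !add0r.
rewrite mulmxN mulmx1 add_col_mx addr0 addNr col_mx0 det_lblock det_lblock det1 mul1r.
rewrite mul_scalar_mx scale_row_mx add_row_mx mul_row_col mulmxN mulmx1 scaler0 addr0.
rewrite mul0mx add0r opprD scalemx1 subrK -!scaleN1r !detZ det1 mulr1 mulrC.
by [].
Qed.

Lemma det_scattering p q (s : 'S_(1 + n + n)) : (forall c, q 0 c != 0) ->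
  (forall c, (p 0 c + q 0 c) * om = 1 + om ^+ 2) ->
  \det (out_block 1 q - in_block 0 p *m perm_mx s) =
  (-1) ^+ s * \det (in_block 1 q *m perm_mx s - out_block 0 p).
Proof.
move=> q0 pq; set N := out_block 1 q; set P := in_block 0 p.
have NU : N^T \in unitmx.
  rewrite unitmx_tr unitmxE det_out_block -scaleN1r detZ det_diag unitrM unitrX ?unitrN1 //=.
  by rewrite unitfE; apply/prodf_neq0.
(* [Z] is the transpose of [N^-1 *m P]. By [scattering_dual] it also solves the system with
   [in_block 1 q], so both determinants contain the factor [\det (perm_mx s - Z)]. *)
pose Z := P^T *m invmx N^T.
have -> : out_block 0 p = in_block 1 q *m Z.
  by rewrite mulmxA -scattering_dual // -mulmxA mulmxV // mulmx1.
rewrite -mulmxBr det_mulmx det_in_block -det_out_block -/N -[LHS]det_tr.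
have -> : (N - P *m perm_mx s)^T = (perm_mx s)^T *m ((perm_mx s - Z) *m N^T).
  rewrite mulmxBl mulmxBr mulmxA tr_perm_mx -perm_mxM mulVg perm_mx1 mul1mx.
  by rewrite -[Z *m _]mulmxA mulVmx // mulmx1 linearB /= trmx_mul tr_perm_mx.
by rewrite !det_mulmx !det_tr det_perm [_ * \det N]mulrC.
Qed.
End Scattering.

(** * Darts, edges and regions *)

Lemma split_lshift m n (i : 'I_m) : split (lshift n i) = inl i.
Proof. exact: (unsplitK (inl i)). Qed.

Lemma split_rshift m n (i : 'I_n) : split (rshift m i) = inr i.
Proof. exact: (unsplitK (inr i)). Qed.

Section Diagram.
Variables (n : nat) (K : diagram n).
Local Notation rot := Defs.rot.
Local Notation al := (alpha K).
Local Notation inn := (is_in (sgn K)).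

Lemma rot_inj : injective (@rot n).
Proof.
move=> [[c i]|b] [[c' i']|b'] //= E.
pose f (d : dart n) := if d is inl x then x else (c, i).
by have /= /pair_equal_spec[-> /ordS_inj->] := congr1 f E.
Qed.

Lemma alpha_inj : injective al.
Proof. exact: inv_inj (alphaK K). Qed.

Lemma fstep_inj : injective (fstep al).
Proof. by move=> x y /alpha_inj/rot_inj. Qed.

Lemma dart_connect_const (S : eqType) (w : dart n -> S) :
  (forall d, w (al d) = w d) -> (forall d, w (rot d) = w d) -> forall d e, w d = w e.
Proof.
move=> wa wr d e; have /connectP[p] := diag_connected K d e.
elim: p d => [|x p IH] d /=; first by move=> _ ->.
by case/andP=> /orP[]/eqP-> /IH H /H <-.
Qed.

(** Sphericity leaves [n + 1] regions, as many as the crossings and one star together; this makes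
    the matrices below square. *)
Lemma region_index : exists rg : dart n -> 'I_(1 + n),
  (forall d e, (rg d == rg e) = same_region K d e) /\ (forall j, exists d, rg d = j).
Proof.
pose S := [set froot (fstep al) d | d : dart n].
have cS : #|S| = (1 + n)%N.
  by move: (diag_sphere K); rewrite /nfaces -/S; lia.
have fS d : froot (fstep al) d \in S by exact: imset_f.
exists (fun d => cast_ord cS (enum_rank_in (fS (inr false)) (froot (fstep al) d))).
split=> [d e|j].
  rewrite (inj_eq (@cast_ord_inj _ _ _)) /same_region.
  rewrite -(root_connect (fconnect_sym fstep_inj)).
  by apply: (inj_in_eq (D := mem S)) => //; exact: can_in_inj (enum_rankK_in _).
have /imsetP[d _ dE] := enum_valP (cast_ord (esym cS) j).
by exists d; apply: val_inj; rewrite /= -dE enum_valK_in.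
Qed.

(* In counterclockwise order from [base c] the half-strands are in, in, out, out, whatever the
   sign; a dart also names the quadrant following it, so [ain c], [bin c], [aout c], [bout c]
   are the quadrants In, R, Out, L. *)
Definition base (c : 'I_n) : 'I_4 := if sgn K c then ord0 else ord_max.
Definition ain c : dart n := inl (c, base c).
Definition bin c : dart n := rot (ain c).
Definition aout c : dart n := rot (bin c).
Definition bout c : dart n := rot (aout c).

Lemma rot4 (d : dart n) : rot (rot (rot (rot d))) = d.
Proof.
case: d => [[c i]|] //=; congr (inl (c, _)); apply: val_inj => /=.
by case: i; do 4!case=> //.
Qed.

Lemma rot_bout c : rot (bout c) = ain c.
Proof. exact: rot4. Qed.

Lemma is_in_ain c : inn (ain c). Proof. by rewrite /= /base; case: (sgn K c). Qed.
Lemma is_in_bin c : inn (bin c). Proof. by rewrite /= /base; case: (sgn K c). Qed.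
Lemma is_in_aout c : inn (aout c) = false.
Proof. by rewrite /= /base; case: (sgn K c). Qed.
Lemma is_in_bout c : inn (bout c) = false.
Proof. by rewrite /= /base; case: (sgn K c). Qed.

Lemma ord4_cases c (i : 'I_4) : [\/ inl (c, i) = ain c, inl (c, i) = bin c,
  inl (c, i) = aout c | inl (c, i) = bout c].
Proof.
have : [|| i == base c, i == ordS (base c), i == ordS (ordS (base c))
    | i == ordS (ordS (ordS (base c)))].
  by rewrite /base; case: (sgn K c); case: i; do 4!case=> //.
by case/or4P => /eqP->; [constructor 1|constructor 2|constructor 3|constructor 4].
Qed.

Variant dart_spec : dart n -> Type :=
  | DartIn1 c : dart_spec (ain c) | DartIn2 c : dart_spec (bin c)
  | DartOut1 c : dart_spec (aout c) | DartOut2 c : dart_spec (bout c)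
  | DartEnd b : dart_spec (inr b).

Lemma dartP d : dart_spec d.
Proof.
case: d => [[c i]|b]; last by constructor.
have [/eqP->|n1] := boolP (inl (c, i) == ain c); first by constructor.
have [/eqP->|n2] := boolP (inl (c, i) == bin c); first by constructor.
have [/eqP->|n3] := boolP (inl (c, i) == aout c); first by constructor.
have -> : inl (c, i) = bout c; last by constructor.
by case: (ord4_cases c i) n1 n2 n3 => -> //; rewrite eqxx.
Qed.

(* Edges are indexed by their outgoing dart. *)
Definition dout (k : 'I_(1 + n + n)) : dart n :=
  match split k with
  | inl k' => match split k' with inl _ => inr false | inr c => aout c end
  | inr c => bout c
  end.

(** [din k] is on the same strand as [dout k]: opposite to it at its crossing, with the head in the
    place of the tail. *)
Definition din (k : 'I_(1 + n + n)) : dart n :=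
  match split k with
  | inl k' => match split k' with inl _ => inr true | inr c => ain c end
  | inr c => bin c
  end.

(** Inverse of [dout] on outgoing darts. The values on incoming darts are arbitrary, and [edge_of]
    avoids them. *)
Definition oidx (d : dart n) : 'I_(1 + n + n) :=
  match d with
  | inl (c, i) => if d == aout c then lshift n (rshift 1 c) else rshift (1 + n) c
  | inr _ => lshift n (lshift n ord0)
  end.

Definition edge_of (d : dart n) := oidx (if inn d then al d else d).

Definition position (d : dart n) : nat := if d is inl x then val x.2 else 0.

Lemma ain_neq_bin c c' : (ain c == bin c') = false.
Proof.
apply/eqP=> E; have cc : c = c' by case: E.
by move: E; rewrite cc => /(congr1 position) /=; rewrite /base; case: (sgn K c').
Qed.

Lemma bout_neq_aout c c' : (bout c == aout c') = false.
Proof.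
apply/eqP=> E; have cc : c = c' by case: E.
by move: E; rewrite cc => /(congr1 position) /=; rewrite /base; case: (sgn K c').
Qed.

Lemma oidx_aout c : oidx (aout c) = lshift n (rshift 1 c).
Proof.
by rewrite -[LHS]/(if aout c == aout c then _ else rshift (1 + n) c) eqxx.
Qed.

Lemma oidx_bout c : oidx (bout c) = rshift (1 + n) c.
Proof.
by rewrite -[LHS]/(if bout c == aout c then lshift n (rshift 1 c) else _) bout_neq_aout.
Qed.

Lemma dout_tail : dout (lshift n (lshift n ord0)) = inr false.
Proof. by rewrite /dout split_lshift split_lshift. Qed.
Lemma dout_aout c : dout (lshift n (rshift 1 c)) = aout c.
Proof. by rewrite /dout split_lshift split_rshift. Qed.
Lemma dout_bout c : dout (rshift (1 + n) c) = bout c.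
Proof. by rewrite /dout split_rshift. Qed.
Lemma din_head : din (lshift n (lshift n ord0)) = inr true.
Proof. by rewrite /din split_lshift split_lshift. Qed.
Lemma din_ain c : din (lshift n (rshift 1 c)) = ain c.
Proof. by rewrite /din split_lshift split_rshift. Qed.
Lemma din_bin c : din (rshift (1 + n) c) = bin c.
Proof. by rewrite /din split_rshift. Qed.

Variant idx_spec : 'I_(1 + n + n) -> Type :=
  | IdxEnd : idx_spec (lshift n (lshift n ord0))
  | IdxA c : idx_spec (lshift n (rshift 1 c))
  | IdxB c : idx_spec (rshift (1 + n) c).

Lemma idxP k : idx_spec k.
Proof.
rewrite -(splitK k); case: (split k) => [j|c] /=; last exact: IdxB.
rewrite -(splitK j); case: (split j) => [i|c] /=; last exact: IdxA.
by rewrite (ord1 i); exact: IdxEnd.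
Qed.

Lemma doutK : cancel dout oidx.
Proof.
by move=> k; case: (idxP k) => [|c|c];
  rewrite ?dout_tail ?dout_aout ?dout_bout ?oidx_aout ?oidx_bout.
Qed.

Lemma is_in_dout k : inn (dout k) = false.
Proof.
by case: (idxP k) => [|c|c]; rewrite ?dout_tail ?dout_aout ?dout_bout ?is_in_aout ?is_in_bout.
Qed.

Lemma is_in_din k : inn (din k).
Proof.
by case: (idxP k) => [|c|c]; rewrite ?din_head ?din_ain ?din_bin ?is_in_ain ?is_in_bin.
Qed.

Lemma oidxK d : ~~ inn d -> dout (oidx d) = d.
Proof.
case: (dartP d) => [c|c|c|c|[]] //; rewrite ?is_in_ain ?is_in_bin //.
- by rewrite oidx_aout dout_aout.
- by rewrite oidx_bout dout_bout.
- by rewrite /= dout_tail.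
Qed.

Lemma edge_alpha d : edge_of (al d) = edge_of d.
Proof. by rewrite /edge_of alpha_orient alphaK; case: (inn d). Qed.

Lemma edge_dout k : edge_of (dout k) = k.
Proof. by rewrite /edge_of is_in_dout doutK. Qed.

Lemma card_dart : #|dart n| = (4 * n + 2)%N.
Proof. by rewrite card_sum card_prod !card_ord card_bool mulnC. Qed.

Variable rg : dart n -> 'I_(1 + n).
Hypothesis rgE : forall d e, (rg d == rg e) = same_region K d e.
Hypothesis rg_surj : forall j, exists d, rg d = j.

Lemma rg_fstep d : rg (al (rot d)) = rg d.
Proof. by apply/eqP; rewrite eq_sym rgE /same_region fconnect1. Qed.

(** * The sign of a state *)

Definition marks (m : 'I_n -> 'I_4) : {set dart n} := [set inl (c, m c) | c in 'I_n].

Lemma mark_inj (m : 'I_n -> 'I_4) : injective (fun c => inl (c, m c) : dart n).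
Proof. by move=> c c' []. Qed.

Lemma mem_marks m c i : (inl (c, i) \in marks m) = (i == m c).
Proof.
apply/imsetP/eqP => [[c' _ [-> ->]]//|->]; by exists c.
Qed.

Lemma end_marks m b : (inr b \in marks m) = false.
Proof. by apply/imsetP => -[]. Qed.

Definition vertex (d : dart n) : 'I_n + bool :=
  match d with inl (c, _) => inl c | inr b => inr b end.

Lemma vertex_rot d : vertex (rot d) = vertex d.
Proof. by case: d => [[c i]|b]. Qed.

(** A state as a permutation; index 0 stands for the star, placed at the end point [inr b]. *)
Definition state_perm (b : bool) (m : 'I_n -> 'I_4) (s : 'S_(1 + n)) :=
  s (lshift n ord0) = rg (inr b) /\ forall c, s (rshift 1 c) = rg (inl (c, m c)).

Section Height.
Local Open Scope ring_scope.

Lemma sum_marks (F : fieldType) m (f : dart n -> F) :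
  \sum_d (d \in marks m)%:R * f d = \sum_c f (inl (c, m c)).
Proof.
transitivity (\sum_(d in marks m) f d).
  rewrite [RHS]big_mkcond; apply: eq_bigr => d _.
  by case: ifP => _; rewrite ?mul1r ?mul0r.
by rewrite big_imset //= => c c' _ _; exact: mark_inj.
Qed.

Lemma sum_marks_region (F : fieldType) b m s j : state_perm b m s ->
  \sum_c (rg (inl (c, m c)) == j)%:R = 1 - (rg (inr b) == j)%:R :> F.
Proof.
case=> s0 sr; have : \sum_i (s i == j)%:R = 1 :> F.
  rewrite (bigD1 ((s^-1)%g j)) //= permKV eqxx big1 ?addr0 // => i ne.
  by case: eqP => // E; rewrite -E permK eqxx in ne.
rewrite big_split_ord big_ord1 s0 => E.
apply: (addrI (rg (inr b) == j)%:R); rewrite [RHS]addrC subrK -[RHS]E.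
by congr (_ + _); apply: eq_bigr => c _; rewrite sr.
Qed.

Lemma rg_sum_fstep (F : fieldType) j (f : dart n -> F) :
  \sum_d f (al (rot d)) * (rg d == j)%:R = \sum_d f d * (rg d == j)%:R.
Proof.
rewrite [RHS](reindex_inj fstep_inj); apply: eq_bigr => d _.
by rewrite /fstep rg_fstep.
Qed.

(* By Euler's formula, a 1-cochain on corners that sums to zero around vertices and along regions
   is a coboundary; here it is the difference of two states modulo 2. *)
Lemma height_exists b m1 m2 s1 s2 : state_perm b m1 s1 -> state_perm b m2 s2 ->
  exists h : dart n -> bool, (forall d, h (al d) = h d) /\
   (forall d, h (rot d) = h d (+) (d \in marks m1) (+) (d \in marks m2)).
Proof.
move=> S1 S2; pose F := 'F_2.
(* The complex goes from edges through corners to vertices and regions: [a] takes the difference of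
   an edge function across a corner, [w] sums around vertices and along regions. *)
pose a k (d : dart n) : F := (edge_of (rot d) == k)%:R - (edge_of d == k)%:R.
pose w (d : dart n) (z : ('I_n + bool) + 'I_(1 + n)) : F :=
  match z with inl v => (vertex d == v)%:R | inr j => - (rg d == j)%:R end.
have sum_edge (u : 'I_(1 + n + n) -> F) d :
    \sum_k u k * a k d = u (edge_of (rot d)) - u (edge_of d).
  rewrite (eq_bigr (fun k => u k * (edge_of (rot d) == k)%:R -
    u k * (edge_of d == k)%:R)); last by move=> k _; rewrite mulrBr.
  have E e : \sum_k u k * (e == k)%:R = u e.
    rewrite (bigD1 e) //= eqxx mulr1 big1 ?addr0 // => k ke.
    by rewrite eq_sym (negbTE ke) mulr0.
  by rewrite sumrB !E.
pose g (d : dart n) : F := (d \in marks m1)%:R - (d \in marks m2)%:R.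
have [||||z|u hu] := @exact_of_const_kernels F _ _ _ a w _ _ _ _ g.
- move=> k [v|j] /=.
    rewrite (eq_bigr (fun d => (edge_of (rot d) == k)%:R * (vertex d == v)%:R -
      (edge_of d == k)%:R * (vertex d == v)%:R)); last by move=> d _; rewrite mulrBl.
    rewrite sumrB [X in _ - X](reindex_inj rot_inj) /= -sumrB big1 // => d _.
    by rewrite vertex_rot subrr.
  rewrite (eq_bigr (fun d => (edge_of d == k)%:R * (rg d == j)%:R -
    (edge_of (al (rot d)) == k)%:R * (rg d == j)%:R)); last first.
    by move=> d _; rewrite mulrN /a edge_alpha mulrBl opprB.
  by rewrite sumrB (rg_sum_fstep _ (fun d => (edge_of d == k)%:R)) subrr.
- move=> u u0 k k'; rewrite -(edge_dout k) -(edge_dout k').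
  apply: (dart_connect_const (w := fun d => u (edge_of d))) => d.
    by rewrite edge_alpha.
  by apply/eqP; rewrite -subr_eq0 -sum_edge u0.
(* Such a vector has equal values at the vertex and at the region of every corner, so connectedness
   makes it constant. *)
- move=> v v0.
  have vr d : v (inl (vertex d)) = v (inr (rg d)).
    move: (v0 d); rewrite big_sumType /= (bigD1 (vertex d)) //= eqxx mulr1 big1; last first.
      by move=> x xd; rewrite eq_sym (negbTE xd) mulr0.
    rewrite (bigD1 (rg d)) //= eqxx mulrN mulr1 big1 ?addr0.
      by move/eqP; rewrite subr_eq0 => /eqP.
    by move=> x xd; rewrite eq_sym (negbTE xd) oppr0 mulr0.
  have vc d d' : v (inl (vertex d)) = v (inl (vertex d')).
    apply: (dart_connect_const (w := fun d => v (inl (vertex d)))) => {}d.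
      have [e ->] : exists e, d = rot e by exists (rot (rot (rot d))); rewrite rot4.
      by rewrite vr rg_fstep -vr vertex_rot.
    by rewrite vertex_rot.
  have vz z : exists d, v z = v (inl (vertex d)).
    case: z => [[c|b']|j]; first by exists (inl (c, ord0)).
      by exists (inr b').
    by have [d <-] := rg_surj j; exists d; rewrite vr.
  by move=> z z'; have [d ->] := vz z; have [d' ->] := vz z'; exact: vc.
(* There are [2n + 1] edges, [n + 2] vertices, [n + 1] regions and [4n + 2] corners. *)
- by rewrite card_dart !card_sum card_bool !card_ord; lia.
(* Both states have one marker at each crossing and one in each region except the common starred
   one, so their difference sums to zero. *)
- have E : \sum_y g y * w y z = \sum_c w (inl (c, m1 c)) z - \sum_c w (inl (c, m2 c)) z.
    rewrite -!(sum_marks _ (fun d => w d z)) -sumrB; apply: eq_bigr => d _; by rewrite mulrBl.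
  rewrite E; case: z {E} => [v|j] /=; first by rewrite subrr.
  by rewrite !sumrN (sum_marks_region _ _ S1) (sum_marks_region _ _ S2) subrr.
- exists (fun d => u (edge_of d) != 0); split=> [d|d]; first by rewrite edge_alpha.
  have /eqP := hu d; rewrite sum_edge eq_sym subr_eq => /eqP->; rewrite /g.
  move: (u _); case: (d \in _); case: (d \in _); do 2!case=> //.
  all: by case.
Qed.
End Height.

Definition rotP : {perm dart n} := perm rot_inj.
Definition alphaP : {perm dart n} := perm alpha_inj.
Definition fstepP : {perm dart n} := perm fstep_inj.

Lemma rotP_alphaP : (rotP * alphaP)%g = fstepP.
Proof. by apply/permP=> d; rewrite permM !permE. Qed.

Lemma porbit_rotP c i j : inl (c, j) \in porbit rotP (inl (c, i)).
Proof.
apply/porbitP; exists (j + 4 - i)%N.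
have E k : (rotP ^+ k)%g (inl (c, i)) = inl (c, iter k (@ordS 4) i).
  by elim: k => [|k IH]; rewrite ?expg0 ?perm1 // expgSr permM IH permE.
have V k : val (iter k (@ordS 4) i) = ((i + k) %% 4)%N.
  elim: k => [|k IH]; first by rewrite addn0 modn_small.
  by rewrite iterS /= IH -addn1 modnDml addn1 addnS.
rewrite E; congr (inl (_, _)); apply: val_inj; rewrite V /=.
by case: i j {E V} => i i4 [j j4] /=; rewrite addnC subnK ?modnDr ?modn_small //; lia.
Qed.

Lemma vertex_porbit x y : y \in porbit rotP x -> vertex y = vertex x.
Proof.
case/porbitP=> k ->; elim: k => [|k IH]; first by rewrite expg0 perm1.
by rewrite expgSr permM permE vertex_rot.
Qed.

Lemma rg_porbit x y : (y \in porbit fstepP x) = (rg x == rg y).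
Proof.
apply/idP/idP => [/porbitP[k ->]|]; last by rewrite rgE; exact: fconnect_porbit.
elim: k => [|k /eqP IH]; first by rewrite expg0 perm1.
by rewrite expgSr permM permE /fstep rg_fstep IH.
Qed.

Lemma big_ord4 (R : Type) (idx : R) (op : Monoid.com_law idx) c (f : 'I_4 -> R) :
  \big[op/idx]_i f i = op (op (f (base c)) (f (ordS (base c))))
    (op (f (ordS (ordS (base c)))) (f (ordS (ordS (ordS (base c)))))).
Proof.
pose g k := f (inord k); have fg i : f i = g (val i) by rewrite /g inord_val.
rewrite (eq_bigr _ (fun i _ => fg i)) !big_ord_recl big_ord0 !fg /base.
have E1 x y z w : op x (op y (op z (op w idx))) = op (op x y) (op z w).
  by rewrite Monoid.mulm1 !Monoid.mulmA.
have E2 x y z w : op x (op y (op z (op w idx))) = op (op w x) (op y z).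
  by rewrite Monoid.mulm1 -[RHS]Monoid.mulmA [RHS]Monoid.mulmC -!Monoid.mulmA.
by case: (sgn K c); [exact: (E1 (g 0) (g 1) (g 2) (g 3)) | exact: (E2 (g 0) (g 1) (g 2) (g 3))].
Qed.

(* The quadrants carrying the sign of a state: In if the star is at the tail ([b = false]), Out
   if it is at the head. *)
Definition hole (b : bool) (c : 'I_n) (q : 'I_4) : bool :=
  (inn (inl (c, q)) == ~~ b) && (inn (rot (inl (c, q))) == ~~ b).

Definition hole_dart (b : bool) c := if b then aout c else ain c.

Lemma hole_dartP b c q : hole b c q = (inl (c, q) == hole_dart b c).
Proof.
have E (r : 'I_4) : (inl (c, q) == inl (c, r) :> dart n) = (val q == val r).
  by apply/eqP/eqP => [[->]//|/val_inj->].
rewrite /hole /hole_dart /aout /bin /ain /= /base.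
case: b; case: (sgn K c); rewrite E; case: q {E} => q lt_q4;
  by move: q lt_q4; do 4!case=> //.
Qed.

(** * Relative sign of two states with the same star *)

Section Kasteleyn.
Variables (b : bool) (m1 m2 : 'I_n -> 'I_4) (s1 s2 : 'S_(1 + n)).
Hypotheses (S1 : state_perm b m1 s1) (S2 : state_perm b m2 s2).
Variables (h : dart n -> bool) (u : 'S_n).
Hypotheses (h_alpha : forall d, h (al d) = h d)
  (h_rot : forall d, h (rot d) = h d (+) (d \in marks m1) (+) (d \in marks m2))
  (h_star : h (inr b) = false)
  (u_eq : forall c, s1 (rshift 1 c) = s2 (rshift 1 (u c))).

Let d1 c : dart n := inl (c, m1 c).
Let d2 c : dart n := inl (c, m2 c).
Let D := [set d | h d].

Lemma d1_marks c : d1 c \in marks m1. Proof. by rewrite mem_marks. Qed.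
Lemma d2_marks c : d2 c \in marks m2. Proof. by rewrite mem_marks. Qed.

Lemma marks1P x : x \in marks m1 -> exists c, x = d1 c.
Proof. by case/imsetP=> c _ ->; exists c. Qed.
Lemma marks2P x : x \in marks m2 -> exists c, x = d2 c.
Proof. by case/imsetP=> c _ ->; exists c. Qed.

Lemma rg_d1 c : rg (d1 c) = s1 (rshift 1 c). Proof. by case: S1 => _ ->. Qed.
Lemma rg_d2 c : rg (d2 c) = s2 (rshift 1 c). Proof. by case: S2 => _ ->. Qed.

Lemma rg_d12 c : rg (d2 (u c)) = rg (d1 c).
Proof. by rewrite rg_d1 rg_d2 u_eq. Qed.

Lemma u_fix c : d1 c = d2 c -> u c = c.
Proof.
move=> E; apply: (@rshift_inj 1 n); apply: (@perm_inj _ s2).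
by rewrite -u_eq -rg_d1 -rg_d2 E.
Qed.

(** The starred region has no marker, so along it the height keeps the value false taken at the
    starred end point. Every other region has a marker. *)
Lemma star_unmarked x : h x -> exists2 y, y \in porbit fstepP x & y \in marks m1.
Proof.
move=> hx; have [i iE] : exists i, s1 i = rg x by exists (s1^-1 (rg x))%g; rewrite permKV.
have [[c ic]|ij] : (exists c, i = rshift 1 c) \/ i = lshift n ord0.
- by rewrite -(splitK i); case: (split i) => j /=; [right; rewrite (ord1 j)|left; exists j].
- by exists (d1 c); rewrite ?d1_marks // rg_porbit -iE ic rg_d1.
have rx : rg (inr b) = rg x by rewrite -iE ij; case: S1.
have : x \in porbit fstepP (inr b) by rewrite rg_porbit rx.
suff H k : h ((fstepP ^+ k)%g (inr b)) = false.
  by case/porbitP=> k xk; move: hx; rewrite xk H.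
elim: k => [|k IH]; first by rewrite expg0 perm1.
have rk : rg ((fstepP ^+ k)%g (inr b)) = rg (inr b).
  by apply/esym/eqP; rewrite -rg_porbit mem_porbit.
rewrite expgSr permM permE h_alpha h_rot IH; move: rk; set y := (fstepP ^+ k)%g (inr b) => rk.
have n1 : y \notin marks m1.
  apply/negP=> /marks1P[c yc]; move: rk; rewrite yc rg_d1; case: S1 => <- _.
  by move/perm_inj/eqP; rewrite eq_rlshift.
have n2 : y \notin marks m2.
  apply/negP=> /marks2P[c yc]; move: rk; rewrite yc rg_d2; case: S2 => <- _.
  by move/perm_inj/eqP; rewrite eq_rlshift.
by rewrite (negbTE n1) (negbTE n2).
Qed.

Lemma exists_tau : exists tau : {perm dart n}, [/\ forall c, tau (d1 c) = d2 c,
  forall c, tau (d2 c) = d1 c &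
  forall x, x \notin marks m1 -> x \notin marks m2 -> tau x = x].
Proof.
have [|||tau [t1 t2 t3]] := @swap_perm _ _ d1 d2; try exact: mark_inj.
  by move=> c c' [].
by exists tau; split=> // x x1 x2; apply: t3; apply/negP=> /codomP[c xc];
  [move: x1; rewrite xc d1_marks | move: x2; rewrite xc d2_marks].
Qed.

(* [u c] is the crossing whose second marker shares its region with the first marker of [c]. *)
Lemma exists_mu : exists mu : {perm dart n}, [/\ forall c, mu (d1 c) = d2 (u c),
  forall c, mu (d2 (u c)) = d1 c &
  forall x, x \notin marks m1 -> x \notin marks m2 -> mu x = x].
Proof.
have [|||mu [t1 t2 t3]] := @swap_perm _ _ d1 (fun c => d2 (u c)).
- exact: mark_inj.
- by move=> c c' /mark_inj/perm_inj.
- move=> c c' E; apply: (@perm_inj _ u); have cu : c = u c' by case: E.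
  by rewrite -cu; apply: u_fix; rewrite [LHS]E -cu.
exists mu; split=> // x x1 x2; apply: t3; apply/negP=> /codomP[c xc].
  by move: x1; rewrite xc d1_marks.
by move: x2; rewrite xc d2_marks.
Qed.

Section Swaps.
Variables (tau mu : {perm dart n}).
Hypotheses (tau1 : forall c, tau (d1 c) = d2 c) (tau2 : forall c, tau (d2 c) = d1 c)
  (tau3 : forall x, x \notin marks m1 -> x \notin marks m2 -> tau x = x)
  (mu1 : forall c, mu (d1 c) = d2 (u c)) (mu2 : forall c, mu (d2 (u c)) = d1 c)
  (mu3 : forall x, x \notin marks m1 -> x \notin marks m2 -> mu x = x).

Lemma mu2' c : mu (d2 c) = d1 (u^-1 c)%g.
Proof. by rewrite -{1}(permKV u c) mu2. Qed.

Lemma rot_step x : h (rotP x) = h x (+) (x \in marks m1) (+) (x \in marks m2).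
Proof. by rewrite permE h_rot. Qed.

Lemma fstep_step x : h (fstepP x) = h x (+) (x \in marks m1) (+) (x \in marks m2).
Proof. by rewrite permE h_alpha h_rot. Qed.

Lemma rot_uniq m x y : x \in marks m -> y \in marks m -> y \in porbit rotP x -> x = y.
Proof.
by case/imsetP=> c _ -> /imsetP[c' _ ->] /vertex_porbit /= [->].
Qed.

Lemma fstep_uniq1 x y : x \in marks m1 -> y \in marks m1 -> y \in porbit fstepP x -> x = y.
Proof.
case/marks1P=> c -> /marks1P[c' ->]; rewrite rg_porbit !rg_d1.
by move/eqP/perm_inj/rshift_inj->.
Qed.

Lemma fstep_uniq2 x y : x \in marks m2 -> y \in marks m2 -> y \in porbit fstepP x -> x = y.
Proof.
case/marks2P=> c -> /marks2P[c' ->]; rewrite rg_porbit !rg_d2.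
by move/eqP/perm_inj/rshift_inj->.
Qed.

Lemma tau12 x : x \in marks m1 -> tau x \in marks m2 /\ tau x \in porbit rotP x.
Proof. by case/marks1P=> c ->; rewrite tau1 d2_marks porbit_rotP. Qed.

Lemma tau21 x : x \in marks m2 -> tau x \in marks m1 /\ tau x \in porbit rotP x.
Proof. by case/marks2P=> c ->; rewrite tau2 d1_marks porbit_rotP. Qed.

Lemma mu12 x : x \in marks m1 -> mu x \in marks m2 /\ mu x \in porbit fstepP x.
Proof. by case/marks1P=> c ->; rewrite mu1 d2_marks rg_porbit rg_d12. Qed.

Lemma mu21 x : x \in marks m2 -> mu x \in marks m1 /\ mu x \in porbit fstepP x.
Proof.
by case/marks2P=> c ->; rewrite mu2' d1_marks rg_porbit -rg_d12 permKV.
Qed.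

Lemma height_rot_neq c : d1 c != d2 c -> h (d2 c) = ~~ h (d1 c).
Proof.
exact: (twist_neq rot_step (@rot_uniq _) (@rot_uniq _) tau3 (d1_marks c) (d2_marks c)
  (porbit_rotP _ _ _)).
Qed.

Lemma height_fstep_neq c : d1 c != d2 (u c) -> h (d2 (u c)) = ~~ h (d1 c).
Proof.
apply: (twist_neq fstep_step fstep_uniq1 fstep_uniq2 mu3 (d1_marks c) (d2_marks _)).
by rewrite rg_porbit rg_d12.
Qed.

(** The height flips from the first marker of [c] to the second marker of [u c] within their region,
    and flips again to the first marker of [u c] around the crossing. Where two of these markers
    coincide, [u] fixes [c]. *)
Lemma u_stable c : ~~ h (d1 c) -> ~~ h (d1 (u c)).
Proof.
move=> hc; have [e|ne] := eqVneq (d1 c) (d2 (u c)).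
  have uc : u c = c by case: e.
  by rewrite uc.
have h2 := height_fstep_neq ne; rewrite (negbTE hc) in h2.
have [e|ne'] := eqVneq (d1 (u c)) (d2 (u c)); last first.
  by move: h2; rewrite (height_rot_neq ne') => ->.
have /perm_inj uc := u_fix e.
by rewrite uc.
Qed.

Lemma tau_stab : (tau * rotP)%g \in 'N(D | 'P)%g.
Proof.
apply: perm_astabs => x; rewrite !inE.
exact: (twist_stable rot_step (@rot_uniq _) (@rot_uniq _) tau12 tau21 tau3).
Qed.

Lemma mu_stab : (mu * fstepP)%g \in 'N(D | 'P)%g.
Proof.
apply: perm_astabs => x; rewrite !inE.
exact: (twist_stable fstep_step fstep_uniq1 fstep_uniq2 mu12 mu21 mu3).
Qed.

Lemma alpha_stab : alphaP \in 'N(D | 'P)%g.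
Proof. by apply: perm_astabs => x; rewrite !inE permE h_alpha. Qed.

(** [rotP * alphaP] is [fstepP] and [mu] is an involution. Restricted to [D], this relates the signs
    coming from vertices, edges and regions to that of [tau * mu]. *)
Lemma tau_rot_alpha : (tau * rotP * alphaP = tau * mu * (mu * fstepP))%g.
Proof.
rewrite -mulgA rotP_alphaP !mulgA; congr (_ * _)%g; rewrite -mulgA.
suff -> : (mu * mu = 1)%g by rewrite mulg1.
apply/permP=> x; rewrite permM perm1.
have [/marks1P[c ->]|x1] := boolP (x \in marks m1); first by rewrite mu1 mu2.
have [/marks2P[c ->]|x2] := boolP (x \in marks m2); first by rewrite mu2' mu1 permKV.
by rewrite !mu3.
Qed.

Lemma tau_mu_stab : (tau * mu)%g \in 'N(D | 'P)%g.
Proof.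
have -> : (tau * mu = tau * rotP * alphaP * (mu * fstepP)^-1)%g.
  by rewrite tau_rot_alpha mulgK.
by rewrite groupM ?groupV ?mu_stab // groupM ?tau_stab ?alpha_stab.
Qed.

(** [tau * mu] sends [d1 c] to [d1 (u^-1 c)] and [d2 c] to [d2 (u c)], and [D] contains exactly one
    of two distinct markers of a crossing. So it acts on [D] as [u^-1] over the stable set [B] and
    as [u] elsewhere. *)
Lemma odd_tau_mu : odd_perm (restr_perm D (tau * mu)) = odd_perm u.
Proof.
pose B := [set c | h (d1 c)].
have uN : u \in 'N(B | 'P)%g.
  by rewrite -astabsC; apply: perm_astabs => c; rewrite !inE; exact: u_stable.
(* [u'] is [u] with its restriction to [B] inverted; the factor [r^-1] occurs twice, so the sign is
   kept. *)
pose r := restr_perm B u; pose u' := (u * r^-1 * r^-1)%g.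
have -> : odd_perm u = odd_perm u'.
  by rewrite !odd_permM -addbA addbb addbF.
have u'B c : h (d1 c) -> u' c = (u^-1 c)%g.
  move=> hc; have cB : c \in B by rewrite inE.
  have rc : r c = u c by rewrite restr_permE.
  have ucB : (u^-1 c)%g \in B.
    have : (u^-1)%g \in 'N(B | 'P)%g by rewrite groupV.
    by move/astabsP => /(_ c) /=; rewrite apermE cB.
  rewrite !permM -rc permK; apply: (@perm_inj _ r); rewrite permKV.
  by rewrite restr_permE // permKV.
have u'nB c : ~~ h (d1 c) -> u' c = u c.
  move=> hc; rewrite !permM.
  have rid c' : ~~ h (d1 c') -> (r^-1 c')%g = c'.
    move=> hc'; apply: (@perm_inj _ r); rewrite permKV restr_perm_id //.
    by rewrite inE.
  by rewrite !rid ?u_stable.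
(* The marker at height true. If there is none, both markers coincide and everything fixes the
   crossing. *)
pose m c := if h (d1 c) then d1 c else d2 c.
have mI : injective m.
  by move=> c c'; rewrite /m; case: ifP => _; case: ifP => _ [].
rewrite (@odd_perm_inj _ _ m u') // => [c|x].
  rewrite {1}/m; case: ifP => hc.
    rewrite restr_permE ?tau_mu_stab ?inE // permM tau1 mu2' u'B // /m ifT //.
    by apply: contraT => /u_stable; rewrite permKV hc.
  rewrite u'nB ?hc // /m (negbTE (u_stable (negbT hc))).
  case: (boolP (h (d2 c))) => hc2; first by rewrite restr_permE ?tau_mu_stab ?inE // permM tau2 mu1.
  rewrite restr_perm_id ?inE // u_fix //; apply: contraNeq hc2 => ne.
  by rewrite (height_rot_neq ne) hc.
move=> xm; have [xD|xD] := boolP (x \in D); last exact: restr_perm_id.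
have hx : h x by move: xD; rewrite inE.
have x1 : x \notin marks m1.
  by apply: contra xm => /marks1P[c xc]; apply/codomP; exists c; rewrite /m -xc hx.
have x2 : x \notin marks m2.
  apply: contra xm => /marks2P[c xc]; apply/codomP; exists c; rewrite /m -xc.
  case: ifP => // hc; apply: contraTeq hx; rewrite xc eq_sym => ne.
  by rewrite (height_rot_neq ne) hc.
by rewrite restr_permE ?tau_mu_stab // permM tau3 ?mu3.
Qed.

(** Edges at height true, each named by its outgoing dart if the star is at the head and by its
    incoming dart if it is at the tail. At a crossing these darts are the two that bound the
    hole. *)
Definition edge_heights := [set d | h d && (inn d == ~~ b)].

Lemma card_height : #|D| = (#|edge_heights|).*2.
Proof.
have E : D :\: edge_heights = al @: edge_heights.
  apply/setP=> d; rewrite -(alphaK K d) mem_imset; last exact: alpha_inj.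
  by rewrite !inE !h_alpha !alpha_orient; case: (h d); case: (inn d); case: b.
rewrite -(cardsID edge_heights D) E card_imset; last exact: alpha_inj.
rewrite -addnn; congr (_ + _); apply: eq_card => d; rewrite !inE.
by case: (h d).
Qed.

Lemma odd_alpha : odd_perm (restr_perm D alphaP) = odd #|edge_heights|.
Proof.
rewrite (@odd_restr_perm _ D edge_heights alphaP
  (fun d => if inn d == ~~ b then d else al d)).
- by rewrite card_height odd_double.
- by move=> d; rewrite !inE permE h_alpha.
- by apply/subsetP=> d; rewrite !inE => /andP[].
- by move=> d; rewrite inE => /andP[_ ->].
- move=> d; rewrite !inE => hd; case: ifP => E; first by rewrite hd E.
  by rewrite h_alpha hd alpha_orient; move: E; case: (inn d); case: b.
- move=> d _; rewrite permE alpha_orient alphaK.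
  by case: (inn d); case: b.
- move=> d _; case: ifP => _; first by exists 0; rewrite expg0 perm1.
  by exists 1; rewrite expg1 permE.
Qed.

(** By [odd_twist] both signs count markers at height true. Around vertices the unstarred end point
    is one more fixed point when its height is true; regions at height true all have a marker. *)
Lemma odd_height_rot : odd_perm (restr_perm D (tau * rotP)) (+)
  odd_perm (restr_perm D (mu * fstepP)) = h (inr (~~ b)).
Proof.
rewrite (odd_twist rot_step (@rot_uniq _) (@rot_uniq _) tau12 tau21 tau3); last first.
  move=> [[c i]|b'] _; last by left; rewrite permE.
  by right; exists (d1 c); rewrite ?porbit_rotP // inE d1_marks.
rewrite (odd_twist fstep_step fstep_uniq1 fstep_uniq2 mu12 mu21 mu3); last first.
  move=> d /star_unmarked[y yd y1]; right; exists y => //.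
  by rewrite inE y1.
rewrite -/D; set X := [set x | _]; set Y := [set x | _].
pose M := [set x | h x && (x \in marks m1 :|: marks m2)].
have -> : Y = M.
  apply/setP=> d; rewrite !inE; case hd: (h d) => //=.
  case: (fstepP d =P d) => [fd|_]; last by rewrite orbF.
  rewrite orbT; apply/esym.
  have [y /porbitP[k ->] y1] := star_unmarked hd.
  suff <- : (fstepP ^+ k)%g d = d by rewrite y1.
  by elim: k {y1} => [|k IH]; rewrite ?expg0 ?perm1 // expgSr permM IH.
pose E := [set d : dart n | h d && (d == inr (~~ b))].
have -> : X = M :|: E.
  apply/setP=> d; rewrite !inE; case hd: (h d) => //=; congr orb.
  rewrite permE; case: d hd => [[c i]|b'] hd /=.
    apply/negbTE/eqP => /(congr1 position) /=.
    by case: i {hd} => i i4 /=; do 4!case: i i4 => [|i i4] //.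
  rewrite eqxx; apply/esym/eqP; congr inr.
  have [bb|] := eqVneq b' b; first by rewrite bb h_star in hd.
  by case: (b'); case: b.
have -> : #|M :|: E| = #|M| + #|E|.
  rewrite cardsU (_ : M :&: E = set0) ?cards0 ?subn0 //.
  apply/setP=> d; rewrite !inE; apply/negP=> /andP[/andP[_ md] /andP[_ /eqP dE]].
  by move: md; rewrite dE !end_marks.
have -> : #|E| = h (inr (~~ b)) :> nat.
  case hb: (h (inr (~~ b))).
    rewrite -[RHS](cards1 (inr (~~ b) : dart n)); apply: eq_card => d; rewrite !inE.
    by case: eqP => [->|_]; rewrite ?hb ?andbF.
  by apply: eq_card0 => d; rewrite !inE; case: eqP => [->|_]; rewrite ?hb ?andbF.
by rewrite oddD oddb; case: (odd _); case: (odd _); case: (h _).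
Qed.

Lemma odd_u : odd_perm u = odd #|edge_heights| (+) h (inr (~~ b)).
Proof.
have := congr1 (fun s => odd_perm (restr_perm D s)) tau_rot_alpha.
have RM s t : s \in 'N(D | 'P)%g -> t \in 'N(D | 'P)%g ->
    odd_perm (restr_perm D (s * t)%g) =
    odd_perm (restr_perm D s) (+) odd_perm (restr_perm D t).
  by move=> sN tN; rewrite (morphM (restr_perm_morphism D)) // odd_permM.
rewrite /= (RM _ _ tau_stab alpha_stab) (RM _ _ tau_mu_stab mu_stab).
rewrite odd_tau_mu odd_alpha -odd_height_rot.
by case: (odd_perm _); case: (odd_perm _); case: (odd_perm _); case: (odd _).
Qed.

Lemma card_edge_heights : #|edge_heights| = h (inr (~~ b)) +
  \sum_c (h (hole_dart b c) + h (rot (hole_dart b c))).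
Proof.
rewrite -sum1_card big_mkcond big_sumType /= addnC; congr addn.
  rewrite (bigD1 b) // (bigD1 (~~ b)) /=; last by case: b.
  rewrite big1 ?addn0; last by move=> b'; case: b; case: b'.
  by rewrite !inE h_star eqxx andbT /=; case: (h _).
transitivity (\sum_(c < n) \sum_(i < 4) if inl (c, i) \in edge_heights then 1 else 0).
  by rewrite pair_bigA; apply: eq_bigr => -[c i].
apply: eq_bigr => c _; rewrite (big_ord4 _ c) /=.
have E d : (if d \in edge_heights then 1 else 0) = h d && (inn d == ~~ b) :> nat.
  by rewrite inE; case: (_ && _).
rewrite -/(ain c) -/(bin c) -/(aout c) -/(bout c) !E is_in_ain is_in_bin is_in_aout is_in_bout.
by rewrite /hole_dart; case: b; rewrite ?andbF ?andbT ?addn0.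
Qed.

(** The two darts bounding a hole differ in height exactly when one of the two states, but not both,
    has its marker there. The contributions of the unstarred end point cancel. *)
Lemma odd_u_holes : odd_perm u = odd (\sum_c (hole b c (m1 c) + hole b c (m2 c))).
Proof.
rewrite odd_u card_edge_heights oddD oddb addbAC addbb addFb.
apply: (big_rec2 (fun x y => odd x = odd y)) => // c x y _ E.
rewrite !oddD E; congr addb; rewrite !oddb h_rot !hole_dartP.
have H m : hole_dart b c \in marks m = (inl (c, m c) == hole_dart b c).
  apply/imsetP/eqP => [[c' _ dE]|<-]; last by exists c.
  have : vertex (hole_dart b c) = inl c by rewrite /hole_dart; case: (b).
  by rewrite dE => -[->].
rewrite !H; case: (h _); by do 2!case: (_ == _).
Qed.
End Swaps.
End Kasteleyn.

Lemma kasteleyn_sign b m1 m2 s1 s2 : state_perm b m1 s1 -> state_perm b m2 s2 ->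
  odd_perm s1 (+) odd_perm s2 =
  odd (\sum_c hole b c (m1 c)) (+) odd (\sum_c hole b c (m2 c)).
Proof.
move=> S1 S2; have [h [ha hr]] := height_exists S1 S2.
(* Complementing the height if necessary makes it false at the star. *)
pose h' d := h d (+) h (inr b).
have ha' d : h' (al d) = h' d by rewrite /h' ha.
have hr' d : h' (rot d) = h' d (+) (d \in marks m1) (+) (d \in marks m2).
  by rewrite /h' hr; case: (h d); case: (h (inr b)); do 2!case: (_ \in _).
have hs : h' (inr b) = false by rewrite /h' addbb.
have [|u uE ->] := @odd_perm_fix_head _ s1 s2; first by case: S1 => ->; case: S2 => ->.
have [tau [t1 t2 t3]] := exists_tau m1 m2.
have [mu [u1 u2 u3]] := exists_mu S1 S2 uE.
rewrite -oddD -big_split /=.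
exact: (odd_u_holes S1 S2 ha' hr' hs uE t1 t2 t3 u1 u2 u3).
Qed.

(** * Edge matrices *)

Definition corner_weight (T : Type) (x y : 'I_n -> T) (z : T) (c : 'I_n) (q : 'I_4) : T :=
  if inl (c, q) == ain c then x c else if inl (c, q) == aout c then y c else z.

Section EdgeMatrices.
Local Open Scope ring_scope.
Variables (F : fieldType) (om : F).
Local Notation N := (1 + n + n)%N.

Definition edge_mx (f : 'I_n -> dart n) : 'M[F]_(n, N) :=
  \matrix_(c, k) (edge_of (f c) == k)%:R.
Definition region_mx (f : 'I_n -> dart n) : 'M[F]_(n, 1 + n) :=
  \matrix_(c, j) (rg (f c) == j)%:R.
Definition end_edge b : 'rV[F]_N := \row_k (edge_of (inr b) == k)%:R.
Definition end_region b : 'rV[F]_(1 + n) := \row_j (rg (inr b) == j)%:R.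

(* The rows are the vectors y = R - om L. *)
Definition jump_mx : 'M[F]_(N, 1 + n) :=
  \matrix_(k, j) ((rg (al (dout k)) == j)%:R - om * (rg (dout k) == j)%:R).

Lemma sum_indicator (I : finType) (i : I) (f : I -> F) : \sum_k (i == k)%:R * f k = f i.
Proof.
rewrite (bigD1 i) //= eqxx mul1r big1 ?addr0 // => k ki.
by rewrite eq_sym (negbTE ki) mul0r.
Qed.

Lemma dout_edge d : dout (edge_of d) = if inn d then al d else d.
Proof. by rewrite /edge_of oidxK //; case: ifP => [|->//]; rewrite alpha_orient => ->. Qed.

Lemma edge_jump f : edge_mx f *m jump_mx =
  \matrix_(c, j) (if inn (f c) then (rg (f c) == j)%:R - om * (rg (al (f c)) == j)%:R
                  else (rg (al (f c)) == j)%:R - om * (rg (f c) == j)%:R).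
Proof.
apply/matrixP=> c j; rewrite [LHS]mxE [RHS]mxE.
rewrite (eq_bigr (fun k => (edge_of (f c) == k)%:R * jump_mx k j)); last by move=> k _; rewrite mxE.
by rewrite sum_indicator mxE dout_edge; case: ifP => // _; rewrite alphaK.
Qed.

Lemma edge_jump_ain : edge_mx ain *m jump_mx = region_mx ain - om *: region_mx bout.
Proof.
rewrite edge_jump; apply/matrixP=> c j; rewrite !mxE is_in_ain.
by rewrite -{2}(rot_bout c) rg_fstep.
Qed.

Lemma edge_jump_bin : edge_mx bin *m jump_mx = region_mx bin - om *: region_mx ain.
Proof.
by rewrite edge_jump; apply/matrixP=> c j; rewrite !mxE is_in_bin rg_fstep.
Qed.

Lemma edge_jump_aout : edge_mx aout *m jump_mx = region_mx bin - om *: region_mx aout.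
Proof.
by rewrite edge_jump; apply/matrixP=> c j; rewrite !mxE is_in_aout rg_fstep.
Qed.

Lemma edge_jump_bout : edge_mx bout *m jump_mx = region_mx aout - om *: region_mx bout.
Proof.
by rewrite edge_jump; apply/matrixP=> c j; rewrite !mxE is_in_bout rg_fstep.
Qed.

(** At an end point the same region lies on both sides of the edge. *)
Lemma end_edge_jump b : end_edge b *m jump_mx = (1 - om) *: end_region b.
Proof.
apply/matrixP=> i j; rewrite [LHS]mxE [RHS]mxE.
rewrite (eq_bigr (fun k => (edge_of (inr b) == k)%:R * jump_mx k j)); last by move=> k _; rewrite mxE.
rewrite sum_indicator !mxE dout_edge /=.
have E : rg (al (inr b)) = rg (inr b) by rewrite -[in LHS](_ : rot (inr b) = inr b) // rg_fstep.
by case: b E => E /=; rewrite ?alphaK E mulrBl mul1r.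
Qed.

Lemma edge_mx_out : col_mx (col_mx (end_edge false) (edge_mx aout)) (edge_mx bout) = 1%:M.
Proof.
apply/matrixP=> i k; rewrite [RHS]mxE -[in RHS](edge_dout i).
case: (idxP i) => [|c|c]; rewrite ?col_mxEu ?col_mxEd mxE.
- by rewrite dout_tail.
- by rewrite dout_aout.
- by rewrite dout_bout.
Qed.

Lemma edge_eq_in d k : inn d -> (edge_of d == k) = (d == al (dout k)).
Proof.
move=> hd; rewrite -(can_eq doutK) dout_edge hd.
by rewrite -(inj_eq alpha_inj) alphaK.
Qed.

Lemma edge_eq_out d k : ~~ inn d -> (edge_of d == k) = (d == dout k).
Proof. by move=> hd; rewrite -(can_eq doutK) dout_edge (negbTE hd). Qed.

Lemma edge_din_inj : injective (fun k => edge_of (din k)).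
Proof.
move=> k k'; move/(congr1 dout); rewrite !dout_edge !is_in_din => /alpha_inj.
case: (idxP k) => [|c|c]; case: (idxP k') => [|c'|c'];
  rewrite ?din_head ?din_ain ?din_bin // => E.
- by case: E => ->.
- by have := ain_neq_bin c c'; rewrite E eqxx.
- by have := ain_neq_bin c' c; rewrite E eqxx.
- by case: E => ->.
Qed.

(** Sends an edge to its predecessor along the strand; the tail edge is preceded by the head
    edge. *)
Definition strand_perm := perm edge_din_inj.

Lemma edge_mx_in : col_mx (col_mx (end_edge true) (edge_mx ain)) (edge_mx bin) =
  perm_mx strand_perm.
Proof.
apply/matrixP=> i k; rewrite [RHS]mxE [RHS]mxE permE.
case: (idxP i) => [|c|c]; rewrite ?col_mxEu ?col_mxEd mxE.
- by rewrite din_head.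
- by rewrite din_ain.
- by rewrite din_bin.
Qed.

(* The linear relation satisfied by the y's of the four edges at a crossing. *)
Definition vertex_mx : 'M[F]_(n, N) :=
  edge_mx bin + om *: edge_mx ain - edge_mx aout - om *: edge_mx bout.

Lemma vertex_jump : vertex_mx *m jump_mx = 0.
Proof.
rewrite /vertex_mx !mulmxBl mulmxDl -!scalemxAl.
rewrite edge_jump_ain edge_jump_bin edge_jump_aout edge_jump_bout.
by apply/matrixP=> c j; rewrite !mxE; ring.
Qed.

Lemma ain_inj : injective ain. Proof. by move=> c c' []. Qed.
Lemma bin_inj : injective bin. Proof. by move=> c c' []. Qed.
Lemma aout_inj : injective aout. Proof. by move=> c c' []. Qed.
Lemma bout_inj : injective bout. Proof. by move=> c c' []. Qed.

(** A vector in the left kernel gives, for each edge, an equation between its values at the two ends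
    with coefficients 1 or [om]. Vanishing therefore spreads along edges, starting from the end
    points, where the extension [v] is 0. *)
Lemma vertex_mx_free : om != 0 -> row_free vertex_mx.
Proof.
move=> om0; rewrite -kermx_eq0; apply/eqP/row_matrixP=> i0; rewrite row0.
have : row i0 (kermx vertex_mx) *m vertex_mx = 0 by apply/sub_kermxP; exact: row_sub.
move: (row i0 _) => l l0.
pose v (d : dart n) := if d is inl (c, _) then l 0 c else 0.
have sumI (f : 'I_n -> dart n) d : injective f ->
    \sum_c l 0 c * (f c == d)%:R = if [pick c | f c == d] is Some c then l 0 c else 0.
  move=> fI; case: pickP => [c /eqP<-|nf]; last by rewrite big1 // => c _; rewrite nf mulr0.
  rewrite -[RHS](sum_indicator c (fun k => l 0 k)); apply: eq_bigr => k _.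
  by rewrite inj_eq // eq_sym mulrC.
have pickI (f : 'I_n -> dart n) c : injective f ->
    [pick c' | f c' == f c] = Some c.
  by move=> fI; case: pickP => [c' /eqP/fI->|/(_ c)] //; rewrite eqxx.
have pick0 (f : 'I_n -> dart n) d : (forall c, (f c == d) = false) ->
    [pick c' | f c' == d] = None.
  by move=> H; case: pickP => // c; rewrite H.
have column_eq k : \sum_c l 0 c * (bin c == al (dout k))%:R +
    om * \sum_c l 0 c * (ain c == al (dout k))%:R -
    \sum_c l 0 c * (aout c == dout k)%:R - om * \sum_c l 0 c * (bout c == dout k)%:R = 0.
  have := congr1 (fun M : 'rV_N => M 0 k) l0; rewrite /vertex_mx !mulmxBr mulmxDr -!scalemxAr.
  rewrite !mxE => E; rewrite -[RHS]E; congr (_ + _ * _ - _ - _ * _); apply: eq_bigr => c _;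
    rewrite !mxE.
  - by rewrite edge_eq_in ?is_in_bin.
  - by rewrite edge_eq_in ?is_in_ain.
  - by rewrite edge_eq_out ?is_in_aout.
  - by rewrite edge_eq_out ?is_in_bout.
have va d : ~~ inn d -> (v (al d) == 0) = (v d == 0).
  move=> hd; have := column_eq (edge_of d); rewrite dout_edge (negbTE hd).
  rewrite (sumI _ _ bin_inj) (sumI _ _ ain_inj) (sumI _ _ aout_inj) (sumI _ _ bout_inj).
  have hd' : inn (al d) by rewrite alpha_orient.
  have [x x0 ->] : exists2 x, x != 0 &
      (if [pick c | bin c == al d] is Some c then l 0 c else 0) +
      om * (if [pick c | ain c == al d] is Some c then l 0 c else 0) = x * v (al d).
    case: (dartP (al d)) hd' => [c|c|c|c|b]; rewrite ?is_in_aout ?is_in_bout // => _.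
    - exists om => //; rewrite (pickI _ _ ain_inj) pick0 ?add0r // => c'.
      by rewrite eq_sym ain_neq_bin.
    - exists 1; first exact: oner_neq0.
      rewrite (pickI _ _ bin_inj) pick0 ?mulr0 ?addr0 ?mul1r // => c'.
      by rewrite ain_neq_bin.
    - by exists 1; rewrite ?oner_neq0 // !pick0 // !mulr0 addr0.
  have [y y0] : exists2 y, y != 0 &
      (if [pick c | aout c == d] is Some c then l 0 c else 0) +
      om * (if [pick c | bout c == d] is Some c then l 0 c else 0) = y * v d.
    case: (dartP d) hd => [c|c|c|c|b]; rewrite ?is_in_ain ?is_in_bin // => _.
    - exists 1; first exact: oner_neq0.
      rewrite (pickI _ _ aout_inj) pick0 ?mulr0 ?addr0 ?mul1r // => c'.
      by rewrite bout_neq_aout.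
    - exists om => //; rewrite (pickI _ _ bout_inj) pick0 ?add0r // => c'.
      by rewrite eq_sym bout_neq_aout.
    - by exists 1; rewrite ?oner_neq0 // !pick0 // !mulr0 addr0.
  move=> yE; rewrite -addrA -opprD yE => /eqP; rewrite subr_eq0 => /eqP E.
  by rewrite -[LHS](mulrI_eq0 _ (mulfI x0)) E (mulrI_eq0 _ (mulfI y0)).
have vc d d' : (v d == 0) = (v d' == 0).
  apply: (dart_connect_const (w := fun d => v d == 0)) => {d d'} [d|[[c i]|b]] //.
  have [hd|/va//] := boolP (inn d).
  by rewrite -[in RHS](alphaK K d) (va (al d)) // alpha_orient hd.
apply/rowP=> c; rewrite mxE; apply/eqP.
by have := vc (inl (c, ord0)) (inr false); rewrite /= eqxx.
Qed.

Definition state_mx (b : bool) (k : 'I_n -> 'I_4 -> F) : 'M[F]_(1 + n) :=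
  col_mx (end_region b) (\matrix_(c, j) \sum_q k c q * (rg (inl (c, q)) == j)%:R).

Lemma corner_weight_mx (x y : 'rV[F]_n) z :
  \matrix_(c, j) (\sum_q corner_weight (x 0) (y 0) z c q * (rg (inl (c, q)) == j)%:R) =
  diag_mx x *m region_mx ain + diag_mx y *m region_mx aout +
  z *: (region_mx bin + region_mx bout).
Proof.
apply/matrixP=> c j; rewrite [LHS]mxE (big_ord4 _ c) /= -/(ain c) -/(bin c) -/(aout c) -/(bout c).
have ne (i k : 'I_4) : val i != val k -> (inl (c, i) == inl (c, k) :> dart n) = false.
  by move=> ik; apply/eqP=> -[E]; rewrite E eqxx in ik.
have w1 : corner_weight (x 0) (y 0) z c (base c) = x 0 c by rewrite /corner_weight eqxx.
have w2 : corner_weight (x 0) (y 0) z c (ordS (base c)) = z.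
  by rewrite /corner_weight !ne //= /base; case: (sgn K c).
have w3 : corner_weight (x 0) (y 0) z c (ordS (ordS (base c))) = y 0 c.
  by rewrite /corner_weight ne ?eqxx //= /base; case: (sgn K c).
have w4 : corner_weight (x 0) (y 0) z c (ordS (ordS (ordS (base c)))) = z.
  by rewrite /corner_weight !ne //= /base; case: (sgn K c).
by rewrite w1 w2 w3 w4 !mul_diag_mx !mxE; ring.
Qed.

Lemma out_block_edges e q : out_block om e q =
  col_mx (col_mx (e *: end_edge false) (diag_mx q *m edge_mx bout))
         (edge_mx aout + om *: edge_mx bout).
Proof.
rewrite -[LHS]mulmx1 -edge_mx_out /out_block !mul_block_col mul_col_mx mul_row_col.
by rewrite !mul0mx !mul_scalar_mx scale1r !addr0 add_col_mx !add0r addr0.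
Qed.

Lemma in_block_edges e q : in_block om e q *m perm_mx strand_perm =
  col_mx (col_mx (e *: end_edge true)
                 ((om%:M - diag_mx q) *m edge_mx ain + edge_mx bin))
         (om *: edge_mx ain + edge_mx bin).
Proof.
rewrite -edge_mx_in /in_block !mul_block_col mul_col_mx mul_row_col.
by rewrite !mul0mx !mul_scalar_mx !scale1r !addr0 add_col_mx !add0r addr0.
Qed.

(** Multiplying by [row_mx jump_mx G] turns edge variables into region variables: the vertex
    relations become [0] and [e%:M], and the remaining block is [S] with its star row scaled by
    [1 - om]. The tail and head systems use the same multiplier. *)
Lemma det_edge_reduce (T : 'M[F]_(1 + n, N)) (S : 'M[F]_(1 + n)) (e : F) G b :
  vertex_mx *m G = 1%:M ->
  T *m jump_mx = col_mx ((1 - om) *: end_region b) (dsubmx S) ->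
  usubmx S = end_region b ->
  \det (col_mx T (e *: vertex_mx)) * \det (row_mx jump_mx G) = (1 - om) * \det S * e ^+ n.
Proof.
move=> vG TJ S0; rewrite -det_mulmx mul_col_row TJ -!scalemxAl vertex_jump vG scaler0.
rewrite det_ublock scalemx1 det_scalar; congr (_ * _).
transitivity (\det (block_mx (1 - om)%:M 0 0 1%:M *m S)).
  congr (\det _); rewrite -[in RHS](vsubmxK S) mul_block_col !mul0mx mul1mx.
  by rewrite mul_scalar_mx addr0 add0r S0.
by rewrite det_mulmx det_lblock det_scalar1 det1 mulr1.
Qed.

Lemma det_state_mx_ends (p q : 'rV[F]_n) : om != 0 -> om != 1 ->
  (forall c, q 0 c != 0) -> (forall c, (p 0 c + q 0 c) * om = 1 + om ^+ 2) ->
  (-1) ^+ n * \det (state_mx false (corner_weight (p 0) (q 0) (-1))) =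
  (-1) ^+ strand_perm *
    \det (state_mx true (corner_weight ((- q) 0) ((- p) 0) 1)).
Proof.
move=> om0 om1 q0 pq.
have vG : vertex_mx *m pinvmx vertex_mx = 1%:M by rewrite mulmxVp // vertex_mx_free.
have om1' : 1 - om != 0 by rewrite subr_eq0 eq_sym.
have pqE c : p 0 c = (1 + om ^+ 2) / om - q 0 c by rewrite -(pq c) mulfK ?addrK.
have := congr1 (fun x => x * \det (row_mx jump_mx (pinvmx vertex_mx)))
  (det_scattering strand_perm q0 pq).
rewrite /= in_block_edges out_block_edges in_block_edges out_block_edges.
rewrite !opp_col_mx !add_col_mx -mulrA.
pose S1 := state_mx false (corner_weight (p 0) (q 0) (-1)).
pose S2 := state_mx true (corner_weight ((- q) 0) ((- p) 0) 1).
have -> : edge_mx aout + om *: edge_mx bout - (om *: edge_mx ain + edge_mx bin) =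
    -1 *: vertex_mx.
  by apply/matrixP=> c k; rewrite !mxE; ring.
have -> : om *: edge_mx ain + edge_mx bin - (edge_mx aout + om *: edge_mx bout) =
    1 *: vertex_mx.
  by apply/matrixP=> c k; rewrite !mxE; ring.
rewrite (@det_edge_reduce _ S1 _ _ false vG) ?col_mxKu //; last first.
  rewrite col_mxKd corner_weight_mx mul_col_mx; congr col_mx.
    by rewrite scale1r scale0r subr0 end_edge_jump.
  (* [q y_bout - (om - p) y_ain - y_bin] equals [p In + q Out - R - L], the coefficient of [L] being
     [om^2 - om (p + q) = -1]. The head system below gives [- q In - p Out + R + L] in the same
     way. *)
  rewrite mulmxBl mulmxDl -!mulmxA edge_jump_ain edge_jump_bin edge_jump_bout.
  rewrite mulmxBl mul_scalar_mx !mul_diag_mx; apply/matrixP=> c j; rewrite !mxE.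
  by rewrite pqE; field.
rewrite (@det_edge_reduce _ S2 _ _ true vG) ?col_mxKu //; last first.
  rewrite col_mxKd corner_weight_mx mul_col_mx; congr col_mx.
    by rewrite scale1r scale0r subr0 end_edge_jump.
  rewrite mulmxBl mulmxDl -!mulmxA edge_jump_ain edge_jump_bin edge_jump_bout.
  rewrite mulmxBl mul_scalar_mx !mul_diag_mx; apply/matrixP=> c j; rewrite !mxE.
  by rewrite pqE; field.
rewrite expr1n mulr1 mulrCA -[LHS]mulrA => /(mulfI om1').
by rewrite mulrC => ->.
Qed.
End EdgeMatrices.

(** * State sums *)

Section StateSums.
Local Open Scope ring_scope.

Definition chosen_region (b : bool) (st : 'I_n -> 'I_4) (i : 'I_(1 + n)) :=
  match split i with inl _ => rg (inr b) | inr c => rg (inl (c, st c)) end.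

Definition choice_mx (F : fieldType) b st : 'M[F]_(1 + n) :=
  \matrix_(i, j) (chosen_region b st i == j)%:R.

(** Multilinearity in the crossing rows: a term chooses one quadrant in each row. *)
Lemma det_state_mx (F : fieldType) b (k : 'I_n -> 'I_4 -> F) :
  \det (state_mx b k) =
  \sum_(st : {ffun 'I_n -> 'I_4}) (\prod_c k c (st c)) * \det (choice_mx F b st).
Proof.
pose t (s : 'S_(1 + n)) (st : {ffun 'I_n -> 'I_4}) : F :=
  \prod_i (chosen_region b st i == s i)%:R.
transitivity (\sum_(s : 'S_(1 + n)) \sum_(st : {ffun 'I_n -> 'I_4})
    (-1) ^+ s * ((\prod_c k c (st c)) * t s st)).
  apply: eq_bigr => s _; rewrite -mulr_sumr; congr (_ * _).
  rewrite big_split_ord big_ord1 /= col_mxEu mxE.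
  rewrite (eq_bigr (fun c => \sum_q k c q * (rg (inl (c, q)) == s (rshift 1 c))%:R)); last first.
    by move=> c _; rewrite col_mxEd mxE.
  rewrite bigA_distr_bigA mulr_sumr; apply: eq_bigr => st _.
  rewrite big_split /= mulrCA; congr (_ * _).
  rewrite /t [RHS]big_split_ord big_ord1 /= /chosen_region split_lshift; congr (_ * _).
  by apply: eq_bigr => c _; rewrite split_rshift.
rewrite exchange_big; apply: eq_bigr => st _; rewrite mulr_sumr; apply: eq_bigr => s _.
by rewrite mulrCA; congr (_ * (_ * _)); apply: eq_bigr => i _; rewrite mxE.
Qed.

(** There are as many regions as crossings plus the star, so injectivity already covers every
    region. *)
Lemma chosen_region_inj b (st : {ffun 'I_n -> 'I_4}) :
  reflect (injective (chosen_region b st)) (is_state K (inr b) st).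
Proof.
apply: (iffP and3P) => [[/forallP s1 /forallP s2 _] i i'|inj].
  rewrite -(splitK i) -(splitK i') /chosen_region !unsplitK.
  case: (split i) => [a|c]; case: (split i') => [a'|c'] => /= E.
  - by rewrite (ord1 a) (ord1 a').
  - by move: (s1 c'); rewrite -rgE E eqxx.
  - by move: (s1 c); rewrite -rgE E eqxx.
  - by have /forallP/(_ c') := s2 c; rewrite -rgE E eqxx => /eqP->.
have r0 : chosen_region b st (lshift n ord0) = rg (inr b).
  by rewrite /chosen_region split_lshift.
have rc c : chosen_region b st (rshift 1 c) = rg (inl (c, st c)).
  by rewrite /chosen_region split_rshift.
split.
- apply/forallP=> c; rewrite -rgE -r0 -rc; apply/eqP=> /inj/eqP.
  by rewrite eq_lrshift.
- apply/forallP=> c; apply/forallP=> c'; rewrite -rgE -!rc; apply/implyP=> /eqP/inj/rshift_inj->.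
  exact: eqxx.
- apply/forallP=> d; have [f _ fK] := injF_bij inj.
  have [[c cE]|dE] : (exists c, rg d = rg (inl (c, st c))) \/ rg d = rg (inr b).
  + rewrite -(fK (rg d)) /chosen_region; case: (split _) => [a|c]; first by right.
    by left; exists c.
  + by apply/orP; right; apply/existsP; exists c; rewrite -rgE cE.
  + by rewrite -rgE dE eqxx.
Qed.

Lemma choice_det_state (F : fieldType) b (st : {ffun 'I_n -> 'I_4}) :
  is_state K (inr b) st ->
  exists2 s, state_perm b st s & \det (choice_mx F b st) = (-1) ^+ (s : 'S_(1 + n)).
Proof.
move/chosen_region_inj=> inj; exists (perm inj).
  by split=> [|c]; rewrite permE /chosen_region ?split_lshift ?split_rshift.
have -> : choice_mx F b st = perm_mx (perm inj).
  by apply/matrixP=> i j; rewrite !mxE permE.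
by rewrite det_perm.
Qed.

Lemma choice_det_nonstate (F : fieldType) b (st : {ffun 'I_n -> 'I_4}) :
  ~~ is_state K (inr b) st -> \det (choice_mx F b st) = 0.
Proof.
move/chosen_region_inj/injectiveP/injectivePn=> [i [i' ii' E]].
by apply: (determinant_alternate ii') => j; rewrite !mxE E.
Qed.

(** Choices that are not states give two equal rows; for states, [kasteleyn_sign] compares with one
    reference state. The sign [eta] is combinatorial, hence the same for all fields. *)
Lemma signed_state_sum b : exists eta : bool, forall (F : fieldType) k,
  \det (state_mx b k) = (-1) ^+ eta *
    \sum_(st : {ffun 'I_n -> 'I_4} | is_state K (inr b) st)
      \prod_c ((-1) ^+ hole b c (st c) * k c (st c)) :> F.
Proof.
pose parity (st : {ffun 'I_n -> 'I_4}) := odd (\sum_c hole b c (st c)).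
have [eta etaP] : exists eta : bool, forall st : {ffun 'I_n -> 'I_4},
    is_state K (inr b) st -> forall s, state_perm b st s -> (s : bool) = eta (+) parity st.
  (* Without any state the sum is empty and any sign will do. *)
  case: (pickP (fun st : {ffun 'I_n -> 'I_4} => is_state K (inr b) st)) => [st0 S0|none]; last first.
    by exists false => st; rewrite none.
  have [s0 P0 _] := choice_det_state rat S0.
  exists (s0 (+) parity st0) => st S s P.
  have := kasteleyn_sign P0 P; rewrite -/(parity st0) -/(parity st).
  by case: (odd_perm s0); case: (odd_perm s); case: (parity st0); case: (parity st).
exists eta => F k; rewrite det_state_mx (bigID (fun st => is_state K (inr b) st)) /=.
rewrite [X in _ + X]big1 ?addr0; last by move=> st /choice_det_nonstate->; rewrite mulr0.
rewrite mulr_sumr; apply: eq_bigr => st S.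
have [s P ->] := choice_det_state F S; rewrite (etaP st S s P) big_split /=.
rewrite prodrXr [RHS]mulrA [LHS]mulrC; congr (_ * _).
by rewrite signr_addb signr_odd.
Qed.

Definition weight_sum (S : comNzRingType) b (x y : 'I_n -> S) (z : S) : S :=
  \sum_(st : {ffun 'I_n -> 'I_4} | is_state K (inr b) st)
     \prod_c corner_weight x y z c (st c).

(** The hole signs turn the tail weights [p, q, -1] into [-p, q, -1], that is [p, -q, 1] up to
    [(-1) ^+ n], and the head weights [-q, -p, 1] into [-q, p, 1]. As [eps] precedes the field, a
    single evaluation can determine it. *)
Lemma weight_sum_ends_sign : exists eps : bool, forall (F : fieldType) (om : F) (p q : 'rV[F]_n),
  om != 0 -> om != 1 -> (forall c, q 0 c != 0) ->
  (forall c, (p 0 c + q 0 c) * om = 1 + om ^+ 2) ->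
  weight_sum false (p 0) ((- q) 0) 1 = (-1) ^+ eps * weight_sum true ((- q) 0) (p 0) 1.
Proof.
have [e0 E0] := signed_state_sum false; have [e1 E1] := signed_state_sum true.
exists (e0 (+) (strand_perm (+) e1)) => F om p q om0 om1 q0 pq.
have := det_state_mx_ends om0 om1 q0 pq; rewrite E0 E1.
have -> : \sum_(st : {ffun 'I_n -> 'I_4} | is_state K (inr false) st)
    \prod_c ((-1) ^+ hole false c (st c) * corner_weight (p 0) (q 0) (-1) c (st c)) =
    (-1) ^+ n * weight_sum false (p 0) ((- q) 0) 1.
  rewrite mulr_sumr; apply: eq_bigr => st _.
  have -> : (-1) ^+ n = \prod_(c < n) (-1) :> F by rewrite prodr_const card_ord.
  rewrite -big_split /=; apply: eq_bigr => c _.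
  rewrite hole_dartP /corner_weight /= mxE; case: ifP => _; rewrite ?expr1 ?expr0; first by [].
  by case: ifP => _; rewrite ?mulN1r ?opprK mul1r.
have -> : \sum_(st : {ffun 'I_n -> 'I_4} | is_state K (inr true) st)
    \prod_c ((-1) ^+ hole true c (st c) * corner_weight ((- q) 0) ((- p) 0) 1 c (st c)) =
    weight_sum true ((- q) 0) (p 0) 1.
  apply: eq_bigr => st _; apply: eq_bigr => c _.
  have ne : (aout c == ain c) = false.
    by apply/eqP=> /(congr1 inn); rewrite is_in_ain is_in_aout.
  rewrite hole_dartP /corner_weight /= !mxE; have [->|_] := eqVneq (inl (c, st c)) (aout c).
    by rewrite ne expr1 mulN1r opprK.
  by rewrite expr0 mul1r.
rewrite mulrCA signrMK => E.
by rewrite -[LHS](signrMK e0) E !signr_addb !mulrA.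
Qed.

Lemma weight_sum_ends (F : fieldType) (om : F) (p q : 'rV[F]_n) :
  om != 0 -> om != 1 -> (forall c, q 0 c != 0) ->
  (forall c, (p 0 c + q 0 c) * om = 1 + om ^+ 2) ->
  weight_sum false (p 0) ((- q) 0) 1 = weight_sum true ((- q) 0) (p 0) 1.
Proof.
have [eps epsP] := weight_sum_ends_sign; move: F om p q.
pose S b := [pred st : {ffun 'I_n -> 'I_4} | is_state K (inr b) st].
have countE b : weight_sum b (fun=> 1) (fun=> 1) 1 = #|S b|%:R :> algC.
  rewrite -sum1_card natr_sum; apply: eq_bigr => st _.
  by apply: big1 => c _; rewrite /corner_weight; case: ifP => // _; case: ifP.
(* At om = i, p = 1, q = -1 both sums count states, which determines the sign. *)
have cmp : #|S false|%:R = (-1) ^+ eps * #|S true|%:R :> algC.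
  have := epsP algC 'i (const_mx 1) (const_mx (-1)) (neq0Ci _).
  have i1 : 'i != 1 :> algC.
    by apply/eqP=> /(congr1 (fun x => x ^+ 2)) /eqP; rewrite sqrCi expr1n eq_sym -addr_eq0 -mulr2n pnatr_eq0.
  move=> /(_ i1).
  have -> : weight_sum false ((const_mx 1 : 'rV[algC]_n) 0) ((- const_mx (-1) : 'rV[algC]_n) 0) 1 =
      #|S false|%:R.
    rewrite -countE; apply: eq_bigr => st _; apply: eq_bigr => c _.
    by rewrite /corner_weight !mxE opprK.
  have -> : weight_sum true ((- const_mx (-1) : 'rV[algC]_n) 0) ((const_mx 1 : 'rV[algC]_n) 0) 1 =
      #|S true|%:R.
    rewrite -countE; apply: eq_bigr => st _; apply: eq_bigr => c _.
    by rewrite /corner_weight !mxE opprK.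
  by apply=> c; rewrite !mxE ?oppr_eq0 ?oner_eq0 // subrr mul0r sqrCi subrr.
case: eps epsP cmp => epsP cmp F om p q om0 om1 q0 pq; last by rewrite (epsP _ _ _ _ om0) ?mul1r.
(* With a minus sign the two numbers of states add up to zero, so there are no states and both sums
   are empty. *)
move/eqP: cmp; rewrite mulN1r -addr_eq0 -natrD pnatr_eq0 addn_eq0 => /andP[c0 c1].
have none b : #|S b| == 0%N -> forall x y z, weight_sum b x y z = 0 :> F.
  move=> /eqP Sb x y z; rewrite /weight_sum big_pred0 // => st.
  exact: (card0_eq Sb st).
by rewrite !none.
Qed.
End StateSums.

End Diagram.

(** * From fields to commutative rings *)

Section Transfer.
Local Open Scope ring_scope.
Variables (n : nat) (K : diagram n).

Lemma potential_weight_sum (R : comUnitRingType) b (W B : R) :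
  potential K (inr b) W B = weight_sum K b
    (fun c => if sgn K c then W else B) (fun c => if sgn K c then - B else - W) 1.
Proof.
apply: eq_bigr => st _; apply: eq_bigr => c _.
rewrite /weight /corner_weight -!(hole_dartP K false) -!(hole_dartP K true) /hole.
by case: (is_in _ _); case: (is_in _ _).
Qed.

Lemma weight_sum_scale (S : comNzRingType) b (x y : 'I_n -> S) (a : S) :
  weight_sum K b (fun c => a * x c) (fun c => a * y c) a =
  a ^+ n * weight_sum K b x y 1.
Proof.
rewrite mulr_sumr; apply: eq_bigr => st _.
have -> : a ^+ n = \prod_(c < n) a by rewrite prodr_const card_ord.
rewrite -big_split /=; apply: eq_bigr => c _.
by rewrite /corner_weight; case: ifP => // _; case: ifP => // _; rewrite mulr1.
Qed.

Lemma weight_sum_morph (S S' : comNzRingType) (f : {rmorphism S -> S'}) b x y z :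
  f (weight_sum K b x y z) = weight_sum K b (f \o x) (f \o y) (f z).
Proof.
rewrite rmorph_sum; apply: eq_bigr => st _; rewrite rmorph_prod.
by apply: eq_bigr => c _; rewrite /corner_weight; case: ifP => // _; case: ifP.
Qed.

Lemma eq_weight_sum (S : comNzRingType) b (x x' y y' : 'I_n -> S) z :
  x =1 x' -> y =1 y' -> weight_sum K b x y z = weight_sum K b x' y' z.
Proof.
move=> xx yy; apply: eq_bigr => st _; apply: eq_bigr => c _.
by rewrite /corner_weight xx yy.
Qed.

(* The weights of the tail diagram multiplied by W = u, which makes them polynomial in u; for the
   head diagram at - 1 / W the two functions exchange their roles. *)
Definition in_weight (S : comNzRingType) (u : S) c := if sgn K c then u ^+ 2 else 1.
Definition out_weight (S : comNzRingType) (u : S) c := if sgn K c then -1 else - u ^+ 2.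

Lemma weight_sum_polyX_field (F : fieldType) (f : {rmorphism {poly int} -> F}) :
  injective f ->
  weight_sum K false (in_weight ('X : {poly int})) (out_weight 'X) 'X =
  weight_sum K true (out_weight 'X) (in_weight 'X) 'X.
Proof.
move=> fI; apply: (fI); rewrite !weight_sum_morph.
have om0 : f 'X != 0 by rewrite -(rmorph0 f) (inj_eq fI) polyX_eq0.
have om1 : f 'X != 1.
  rewrite -(rmorph1 f) (inj_eq fI).
  by apply/eqP=> /(congr1 (fun p : {poly int} => p`_0)); rewrite coefX coef1.
(* With [om] the image of ['X], [p] and [q] are [om] and its inverse in an order given by the sign,
   so [(p + q) om = 1 + om^2]; [p] and [- q] are the weights of In and Out. *)
pose p : 'rV_n := \row_c (if sgn K c then (f 'X) else (f 'X)^-1).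
pose q : 'rV_n := \row_c (if sgn K c then (f 'X)^-1 else (f 'X)).
have [rg [rgE rgS]] := region_index K.
have main : weight_sum K false (p 0) ((- q) 0) 1 = weight_sum K true ((- q) 0) (p 0) 1.
  apply: (weight_sum_ends rgE rgS om0 om1) => c; rewrite !mxE.
    by case: (sgn K c); rewrite ?invr_eq0.
  by case: (sgn K c); field.
have inE c : (f \o in_weight ('X : {poly int})) c = (f 'X) * p 0 c.
  by rewrite /= mxE /in_weight; case: (sgn K c); rewrite ?rmorphXn ?rmorph1 ?divff.
have outE c : (f \o out_weight ('X : {poly int})) c = (f 'X) * (- q) 0 c.
  rewrite /= !mxE /out_weight; case: (sgn K c); rewrite mulrN ?divff // rmorphN ?rmorph1 //.
  by rewrite rmorphXn.
rewrite !(eq_weight_sum _ _ inE outE) !(eq_weight_sum _ _ outE inE).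
by rewrite !weight_sum_scale main.
Qed.

Lemma weight_sum_polyX :
  weight_sum K false (in_weight ('X : {poly int})) (out_weight 'X) 'X =
  weight_sum K true (out_weight 'X) (in_weight 'X) 'X.
Proof.
apply: (@weight_sum_polyX_field _ (@FracField.tofrac {poly int})) => x y /eqP.
by rewrite tofrac_eq => /eqP.
Qed.

(** The identity over the integral polynomials, obtained in their fraction field, is evaluated at
    [w]; so it also holds in rings with zero divisors. *)
Lemma weight_sum_universal (R : comNzRingType) (w : R) :
  weight_sum K false (in_weight w) (out_weight w) w =
  weight_sum K true (out_weight w) (in_weight w) w.
Proof.
pose f : {rmorphism {poly int} -> R} :=
  horner_morph ((fun a : int => mulrC _ _) : commr_rmorph (intr : int -> R) w).
have fX : f 'X = w by exact: horner_morphX.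
have := congr1 f weight_sum_polyX; rewrite !weight_sum_morph fX.
have inE : f \o in_weight 'X =1 in_weight w.
  by move=> c; rewrite /= /in_weight; case: (sgn K c); rewrite ?rmorphXn ?rmorph1 ?fX.
have outE : f \o out_weight 'X =1 out_weight w.
  by move=> c; rewrite /= /out_weight; case: (sgn K c); rewrite rmorphN ?rmorphXn ?rmorph1 ?fX.
by rewrite (eq_weight_sum _ _ inE outE) (eq_weight_sum _ _ outE inE).
Qed.
End Transfer.

Local Open Scope ring_scope.

Theorem theorem4p6 (n : nat) (K : diagram n) (R : comUnitRingType) (w : R) :
  w \is a GRing.unit ->
  mockAlex K (tail_dart n) w = mockAlex K (head_dart n) (- w^-1).
Proof.
(* Multiplying by the unit [w ^+ n] clears the inverses of [w], one factor [w] per crossing. *)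
move=> wU; apply: (can_inj (mulKr (unitrX n wU))).
rewrite /mockAlex /tail_dart /head_dart !potential_weight_sum -!weight_sum_scale.
rewrite (invrN w^-1) invrK.
transitivity (weight_sum K false (in_weight K w) (out_weight K w) w).
  by apply: eq_weight_sum => c; rewrite /in_weight /out_weight;
    case: (sgn K c); rewrite ?mulrN ?divrr.
rewrite weight_sum_universal; apply: eq_weight_sum => c;
  by rewrite /in_weight /out_weight; case: (sgn K c); rewrite ?opprK ?mulrN ?divrr.
Qed.
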